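(* Let $(X,d)$ be a Polish metric space, $1<p<\infty$, $E:\mathcal P_p(X)\to(-\infty,+\infty]$ a proper functional and $G:\mathcal P_p(X)\to[0,+\infty]$ a weak upper gradient for $E$. Fix $\rho_0\in Z_{E,p}$ and a $p$-curve of maximal slope $\rho\in AC([0,\infty);\mathcal P_p(X))$ for $E$ with respect to $G$ with $\rho(0)=\rho_0$. (i) If (A1), (A3) hold and either (A2) or (A2') holds, then $\omega^\rho(\rho_0)\subset\mathcal E$. (ii) If $E$ and $G$ admit extensions $\tilde E,\tilde G$ to $\mathcal P(X)$ satisfying (B1), (B3) and either (B2) or (B2'), then $\omega'^\rho(\rho_0)\subset\mathcal E_w$.
   Context: $\mathcal P(X)$ is the set of Borel probability measures on $X$ with the narrow topology (coarsest topology making $\rho\mapsto\int\varphi\,d\rho$ continuous for all bounded continuous $\varphi$), metrised by the Lévy–Prokhorov metric $d_{LP}$. $\mathcal P_p(X)$ is the set of $\rho\in\mathcal P(X)$ with finite $p$-th moment, equipped with the $p$-Wasserstein distance $W_p$. The $\sigma$-topology on $\mathcal P_p(X)$ is the narrow topology restricted to $\mathcal P_p(X)$ (metrised by the restriction $d_\sigma$ of $d_{LP}$). Let $q=p/(p-1)$. A curve $\rho:[0,\infty)\to\mathcal P_p(X)$ is in $AC([0,\infty);\mathcal P_p(X))$ if for each $T>0$ there is $m\in L^1([0,T])$ with $W_p(\rho(t),\rho(s))\le\int_s^t m(r)\,dr$ for all $0\le s<t\le T$; its metric derivative $|\rho'|(t)=\lim_{s\to t}W_p(\rho(t),\rho(s))/|t-s|$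 exists for a.e. $t$. $G$ is a weak upper gradient for $E$ if for every $T>0$ and every absolutely continuous curve $\rho$ on $[0,T]$ with $(G\circ\rho)|\rho'|\in L^1([0,T])$, $E\circ\rho$ is a.e. equal to a function $\varphi$ of finite pointwise variation on $[0,T]$ with $|\varphi'(t)|\le G(\rho(t))|\rho'|(t)$ for a.e. $t$. A $p$-curve of maximal slope for $E$ w.r.t. $G$ is $\rho\in AC([0,\infty);\mathcal P_p(X))$ such that $E\circ\rho$ is a.e. equal to a non-increasing map $\varphi$ with $\varphi'(t)=-\frac1p|\rho'|^p(t)-\frac1q G^q(\rho(t))$ for a.e. $t\ge0$. $Z_{E,p}=\{\rho\in\mathcal P_p(X):E(\rho)<\infty\}$. A stationary state is $\mu\in\mathcal P_p(X)$ with $E(\mu)<\infty$ such that the constant curve $\rho(t)\equiv\mu$ is a $p$-curve of maximal slope; $\mathcal E$ denotes the set of stationary states. If $\tilde E:\mathcal P(X)\to(-\infty,+\infty]$ and $\tilde G:\mathcal P(X)\to[0,+\infty]$ coincide with $E,G$ on $\mathcal P_p(X)$, a weak stationary state is $\mu\in\mathcal P(X)$ with $\tilde E(\mu)<\infty$ and $\tilde G(\mu)=0$; $\mathcal E_w$ denotes their set. $\omega^\rho(\rho_0)=\{\bar\rho\in\mathcal P_p(X):\exists t_n\to\infty,\ \rho(t_n)\to\bar\rho$ in the $\sigma$-topology$\}$; $\omega'^\rho(\rho_0)=\{\bar\rho\in\mathcal P(X):\exists t_n\to\infty,\ \rho(t_n)\to\bar\rho$ narrowly in $\mathcal P(X)\}$.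 Assumptions: (A1) $E$ is proper, bounded below and l.s.c. w.r.t. the $\sigma$-topology. (A2) For every $C\in\mathbb R$, $\{\mu\in\mathcal P_p(X):E(\mu)\le C\}$ is relatively compact in the $\sigma$-topology. (A2') There is a set $\mathcal Y\subset\mathcal P_p(X)$ with $\rho(t)\in\mathcal Y$ for all $t\ge0$ such that for every $C$, $\{\mu\in\mathcal P_p(X)\cap\mathcal Y:E(\mu)\le C\}$ is relatively compact in the $\sigma$-topology. (A3) $G$ is l.s.c. w.r.t. the $\sigma$-topology. (B1) $\tilde E$ is proper, bounded below and l.s.c. on $\mathcal P(X)$. (B2) For every $C$, $\{\mu\in\mathcal P(X):\tilde E(\mu)\le C\}$ is relatively compact in $\mathcal P(X)$. (B2') There is $\mathcal Y\subset\mathcal P(X)$ with $\rho(t)\in\mathcal Y$ for all $t$ such that for every $C$, $\{\mu\in\mathcal P_p(X)\cap\mathcal Y:E(\mu)\le C\}$ is relatively compact in $\mathcal P(X)$. (B3) $\tilde G$ is l.s.c. on $\mathcal P(X)$. *)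

(* Defs.v *)
From HB Require Import structures.
From mathcomp Require Import all_boot all_order all_algebra.
From mathcomp Require Import all_classical all_reals all_analysis.
Set Implicit Arguments. Unset Strict Implicit. Unset Printing Implicit Defensive.
Import Order.TTheory GRing.Theory Num.Theory.
Import numFieldNormedType.Exports.
Local Open Scope classical_set_scope.
Local Open Scope ring_scope.

Section Defs.
Context {R : realType} {d : measure_display} {X : measurableType d}.
Variable dX : X -> X -> R.

Definition is_metric : Prop :=
  (forall x y, 0 <= dX x y) /\ (forall x y, dX x y = 0 <-> x = y) /\
  (forall x y, dX x y = dX y x) /\
  (forall x y z, dX x z <= dX x y + dX y z).

Definition dopen (U : set X) : Prop :=
  forall x, U x -> exists2 r : R, 0 < r & forall y, dX x y < r -> U y.

Definition dcauchy (u : nat -> X) : Prop :=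
  forall e : R, 0 < e -> exists N : nat, forall m n, (N <= m)%N -> (N <= n)%N ->
    dX (u m) (u n) < e.

Definition dconverges (u : nat -> X) (x : X) : Prop :=
  (fun n => dX (u n) x) @ \oo --> (0 : R).

Definition dcomplete : Prop :=
  forall u, dcauchy u -> exists x, dconverges u x.

Definition dseparable : Prop :=
  exists D : set X, countable D /\
    forall x (e : R), 0 < e -> exists2 y, D y & dX x y < e.

Definition polish_metric : Prop := is_metric /\ dcomplete /\ dseparable.

Definition borel_sigma : Prop := @measurable d X = <<s dopen >>.

Definition bounded_continuous (phi : X -> R) : Prop :=
  (exists M : R, forall x, `|phi x| <= M) /\
  (forall x (e : R), 0 < e -> exists2 del : R, 0 < del &
     forall y, dX x y < del -> `|phi x - phi y| < e).

Local Notation PX := (probability X R).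

Definition narrow_cvg (mu : nat -> PX) (nu : PX) : Prop :=
  forall phi : X -> R, bounded_continuous phi ->
    (fun n => (\int[mu n]_x (phi x)%:E)%E) @ \oo --> (\int[nu]_x (phi x)%:E)%E.

Variable p : R.

Definition Pp (mu : PX) : Prop :=
  exists x0 : X, (\int[mu]_x ((dX x0 x) `^ p)%:E < +oo)%E.

Definition coupling (mu nu : PX) (g : probability (X * X)%type R) : Prop :=
  forall A : set X, measurable A ->
    g (A `*` setT) = mu A /\ g (setT `*` A) = nu A.

(* p-Wasserstein distance (the infimum is finite on P_p x P_p) *)
Definition Wp (mu nu : PX) : R :=
  (fine (ereal_inf [set (\int[g]_z ((dX z.1 z.2) `^ p)%:E)%E | g in coupling mu nu]))
    `^ (p^-1).

Definition qexp : R := p / (p - 1).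

(* sigma-topology notions (sequential: the narrow topology is metrised  *)
(* by the Levy-Prokhorov metric)                                       *)

Definition lsc_sigma (F : PX -> \bar R) : Prop :=
  forall (mu : nat -> PX) (nu : PX), (forall n, Pp (mu n)) -> Pp nu ->
    narrow_cvg mu nu -> (F nu <= limn_einf (fun n => F (mu n)))%E.

Definition lsc_narrow (F : PX -> \bar R) : Prop :=
  forall (mu : nat -> PX) (nu : PX),
    narrow_cvg mu nu -> (F nu <= limn_einf (fun n => F (mu n)))%E.

Definition increasing_nat (phi : nat -> nat) : Prop :=
  forall m n, (m < n)%N -> (phi m < phi n)%N.

Definition relcompact_sigma (A : set PX) : Prop :=
  forall mu : nat -> PX, (forall n, A (mu n)) ->
    exists phi : nat -> nat, increasing_nat phi /\
      exists2 nu : PX, Pp nu & narrow_cvg (mu \o phi) nu.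

Definition relcompact_narrow (A : set PX) : Prop :=
  forall mu : nat -> PX, (forall n, A (mu n)) ->
    exists phi : nat -> nat, increasing_nat phi /\
      exists nu : PX, narrow_cvg (mu \o phi) nu.

Local Notation leb := (@lebesgue_measure R).

Definition AC_on (T : R) (rho : R -> PX) : Prop :=
  (forall t, 0 <= t <= T -> Pp (rho t)) /\
  exists m : R -> R, leb.-integrable `[0, T] (EFin \o m) /\
    forall s t, 0 <= s -> s < t -> t <= T ->
      ((Wp (rho t) (rho s))%:E <= \int[leb]_(r in `[s, t]) (m r)%:E)%E.

Definition AC_loc (rho : R -> PX) : Prop :=
  (forall t, 0 <= t -> Pp (rho t)) /\ forall T, 0 < T -> AC_on T rho.

Definition metric_derivative (rho : R -> PX) (t : R) : R :=
  lim ((fun s => Wp (rho t) (rho s) / `|t - s|) @ t^').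

Variables (E G : PX -> \bar R).

Definition weak_upper_gradient : Prop :=
  forall (T : R) (rho : R -> PX), 0 < T -> AC_on T rho ->
    leb.-integrable `[0, T]
      (fun t => (G (rho t) * (metric_derivative rho t)%:E)%E) ->
    exists phi : R -> R,
      {ae leb, forall t, (`[0, T]%classic) t -> E (rho t) = (phi t)%:E} /\
      bounded_variation 0 T phi /\
      {ae leb, forall t, (`[0, T]%classic) t ->
         derivable phi t 1 /\
         ((`|derive1 phi t|)%:E <= G (rho t) * (metric_derivative rho t)%:E)%E}.

Definition max_slope_curve (rho : R -> PX) : Prop :=
  AC_loc rho /\
  exists phi : R -> R,
    {ae leb, forall t, 0 <= t -> E (rho t) = (phi t)%:E} /\
    (forall s t, 0 <= s -> s <= t -> phi t <= phi s) /\
    {ae leb, forall t, 0 <= t ->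
       derivable phi t 1 /\
       ((derive1 phi t)%:E = - ((metric_derivative rho t `^ p) / p)%:E
                          - poweR (G (rho t)) qexp * (qexp^-1)%:E)%E}.

Definition ZEp (mu : PX) : Prop := Pp mu /\ (E mu < +oo)%E.

Definition stationary (mu : PX) : Prop :=
  Pp mu /\ (E mu < +oo)%E /\ max_slope_curve (fun _ => mu).

Definition omega_limit (rho : R -> PX) (nu : PX) : Prop :=
  Pp nu /\ exists tn : nat -> R, tn @ \oo --> +oo /\ narrow_cvg (rho \o tn) nu.

Definition omega'_limit (rho : R -> PX) (nu : PX) : Prop :=
  exists tn : nat -> R, tn @ \oo --> +oo /\ narrow_cvg (rho \o tn) nu.

Definition proper_on_Pp : Prop :=
  (forall mu, Pp mu -> E mu != -oo%E) /\ exists2 mu, Pp mu & (E mu < +oo)%E.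

Definition nonneg_on_Pp : Prop := forall mu, Pp mu -> (0 <= G mu)%E.

Definition A1 : Prop :=
  proper_on_Pp /\ (exists c : R, forall mu, Pp mu -> (c%:E <= E mu)%E) /\
  lsc_sigma E.
Definition A2 : Prop :=
  forall C : R, relcompact_sigma [set mu | Pp mu /\ (E mu <= C%:E)%E].
Definition A2' (rho : R -> PX) : Prop :=
  exists2 Y : set PX, (forall t, 0 <= t -> Y (rho t)) &
    forall C : R, relcompact_sigma [set mu | Pp mu /\ Y mu /\ (E mu <= C%:E)%E].
Definition A3 : Prop := lsc_sigma G.

Definition extends (Et Gt : PX -> \bar R) : Prop :=
  (forall mu, Et mu != -oo%E) /\ (forall mu, (0 <= Gt mu)%E) /\
  (forall mu, Pp mu -> Et mu = E mu /\ Gt mu = G mu).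

Definition B1 (Et : PX -> \bar R) : Prop :=
  (exists mu, (Et mu < +oo)%E) /\ (exists c : R, forall mu, (c%:E <= Et mu)%E) /\
  lsc_narrow Et.
Definition B2 (Et : PX -> \bar R) : Prop :=
  forall C : R, relcompact_narrow [set mu | (Et mu <= C%:E)%E].
Definition B2' (rho : R -> PX) : Prop :=
  exists2 Y : set PX, (forall t, 0 <= t -> Y (rho t)) &
    forall C : R, relcompact_narrow [set mu | Pp mu /\ Y mu /\ (E mu <= C%:E)%E].
Definition B3 (Gt : PX -> \bar R) : Prop := lsc_narrow Gt.

End Defs.

Definition weak_stationary {R : realType} {d : measure_display} {X : measurableType d}
  (Et Gt : probability X R -> \bar R) (mu : probability X R) : Prop :=
  (Et mu < +oo)%E /\ Gt mu = 0%E.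

(* Main.v *)
(** Along the curve the energy has a non-increasing representative [phi] which is
    bounded below, so [phi a - phi (a + 2)] tends to [0] as [a] grows.  Since
    [-phi' = |rho'|^p / p + G^q / q] almost everywhere, every window [[t_n, t_n + 1]]
    contains a time [s_n] with [G (rho s_n)] small, and Young's inequality applied to
    [Wp (rho s_n) (rho t_n) <= \int |rho'|] shows that this distance vanishes.  Hence
    [rho s_n] has the same narrow limit as [rho t_n], and lower semicontinuity gives
    [E < +oo] and [G = 0] at the limit, which makes the constant curve a curve of
    maximal slope.

    The bound by [\int |rho'|] requires the metric derivative to exist almost
    everywhere, hence the triangle inequality for [Wp]. *)
Require Import Defs.
From HB Require Import structures.
From mathcomp Require Import all_boot all_order all_algebra.
From mathcomp Require Import all_classical all_reals all_analysis.
From mathcomp Require Import measurable_realfun ring lra.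
Set Implicit Arguments. Unset Strict Implicit. Unset Printing Implicit Defensive.
Import Order.TTheory GRing.Theory Num.Theory.
Import numFieldNormedType.Exports.
Local Open Scope classical_set_scope.
Local Open Scope ring_scope.

(** * Gluing of couplings and the Wasserstein distance *)

(** [E] agrees with [phi] only almost everywhere, and so does the slope identity, so nothing is
    known at the times [t_n] themselves. The shift to [s_n] also selects times with
    [E (rho s_n) = phi s_n], which bounds the energies before semicontinuity is applied. As [phi] is
    monotone but may jump, only half of the fundamental theorem is available: the integral of
    [-phi'] is at most the drop of [phi]. It comes from Fatou's lemma with steps of length at most
    1, whence windows of length 1 but drops over length 2. Young's inequality takes the form
    [a <= del + del^(1-p) * a^p], linear in [a^p], so [|rho'|] is bounded by the derivative of the
    monotone function [del * t - c * phi t] and the same half applies. [metric_derivative] is a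
    [lim], meaningless where no limit exists, so a density controlling the distances has to be
    identified with it. Small [Wp] transfers narrow limits on Lipschitz test functions first, then
    on all bounded continuous ones by approximation from below. *)

Section PolishMetric.
Context {R : realType} {d : measure_display} {X : measurableType d}.
Context (dX : X -> X -> R) (dX_polish : polish_metric dX) (dX_borel : borel_sigma dX).

Lemma polish_ge0 x y : 0 <= dX x y. Proof. by case: dX_polish => -[]. Qed.

Lemma polish_refl x : dX x x = 0.
Proof. by case: dX_polish => -[_ [/(_ x x) h _]] _; apply/h. Qed.

Lemma polish_sym x y : dX x y = dX y x. Proof. by case: dX_polish => -[_ [_ []]]. Qed.

Lemma polish_triangle y x z : dX x z <= dX x y + dX y z.
Proof. by case: dX_polish => -[_ [_ [_ ]]]. Qed.

Lemma measurable_dball x (r : R) : measurable [set y | dX x y < r].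
Proof.
rewrite dX_borel; apply: sub_sigma_algebra => y /= xy.
exists (r - dX x y) => [|z yz /=]; first by rewrite subr_gt0.
by rewrite (le_lt_trans (polish_triangle y _ _))// -ltrBrDl.
Qed.

Lemma dense_sequence : exists u : nat -> X,
  forall x (e : R), 0 < e -> exists n, dX x (u n) < e.
Proof.
case: dX_polish => _ [_ [D [cD denseD]]].
have [y0 Dy0 _] := denseD point 1 ltr01.
have /pfcard_geP[D0|[f]] : (D #<= [set: nat])%card by [].
  by move: Dy0; rewrite D0.
exists f => x e e0; have [y Dy xy] := denseD x e e0.
have [n _ fn] := @surj _ _ _ _ f y Dy.
by exists n; rewrite fn.
Qed.

(** Codes of no rational default to 0; only surjectivity onto the rationals matters. *)
Definition rat_enum (m : nat) : rat := odflt 0 (unpickle m).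

(** The product carries the product sigma-algebra, so continuity alone does not conclude.
    Separability writes each sublevel set as a countable union of products of balls with rational
    radii. *)
Lemma measurable_dist : measurable_fun setT (fun z : X * X => dX z.1 z.2).
Proof.
have [u udense] := dense_sequence.
apply: (@measurability _ _ _ _ _ _ (@RGenInftyO.G R)).
  exact: RGenInftyO.measurableE.
move=> _ [_ [r ->] <-]; rewrite setTI.
rewrite (_ : _ @^-1` _ = \bigcup_n \bigcup_m
    ([set x | dX (u n) x < ratr (rat_enum m)] `*`
     [set y | dX (u n) y < r - ratr (rat_enum m)])); last first.
  apply/seteqP; split => -[x y] /=; rewrite in_itv/=.
    (* With [e] half the gap, a center within [e / 2] of [x] and a rational [q < e] above its
       distance to [x] leave [y] within [r - q] of that center. *)
    move=> xy; pose e := (r - dX x y) / 2.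
    have e0 : 0 < e by rewrite divr_gt0// subr_gt0.
    have [n xn] := udense x (e / 2) ltac:(by rewrite divr_gt0).
    have [q] := @rat_in_itvoo R (dX (u n) x) (e / 2) ltac:(by rewrite polish_sym).
    rewrite in_itv/= => /andP[q1 q2].
    exists n => //; exists (pickle q) => //; rewrite /rat_enum pickleK/=.
    split => //; have := polish_triangle x (u n) y.
    have -> : r = dX x y + 2 * e by rewrite /e; field.
    by move: q2 e0 => /=; lra.
  move=> [n _ [m _ [/= h1 h2]]].
  by have := polish_triangle (u n) x y; rewrite (polish_sym x (u n)); lra.
apply: bigcupT_measurable => n; apply: bigcupT_measurable => m.
by apply: measurableX; exact: measurable_dball.
Qed.

Lemma measurable_dist_powR p : measurable_fun setT (fun z : X * X => dX z.1 z.2 `^ p).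
Proof. by apply: (measurableT_comp (measurable_powR _)); exact: measurable_dist. Qed.

(** Balls of radius [e / 2] around a dense sequence, made disjoint. These are the cells for the
    gluing, and [e] is the error it commits. *)
Lemma small_partition (e : R) : 0 < e -> exists A : nat -> set X,
  [/\ forall k, measurable (A k), trivIset setT A, \bigcup_k A k = setT &
      forall k x y, A k x -> A k y -> dX x y < e].
Proof.
move=> e0; have [u udense] := dense_sequence.
pose B k := [set y | dX (u k) y < e / 2].
have mB k : measurable (B k) by exact: measurable_dball.
exists (seqDU B); split.
- move=> k; apply: measurableD => //.
  by apply: bigsetU_measurable => i _.
- exact: trivIset_seqDU.
- rewrite -seqDU_bigcup_eq -subTset => x _.
  have [n xn] := udense x (e / 2) ltac:(by rewrite divr_gt0).
  by exists n => //; rewrite /B/= polish_sym.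
- move=> k x y [xk _] [yk _]; have := polish_triangle (u k) x y.
  by rewrite (polish_sym x (u k)); move: xk yk; rewrite /B/=; lra.
Qed.

End PolishMetric.

(* Without disintegration: conditionally on the cell [A k] containing the middle
   coordinate, the two couplings are made independent, so that the two middle
   coordinates agree only up to the cell size. *)
Section Gluing.
Context {R : realType} {d : measure_display} {X : measurableType d}.
Context (mu nu kap : probability X R) (g1 g2 : probability (X * X)%type R).
Context (A : nat -> set X).
Hypothesis mA : forall k, measurable (A k).
Hypothesis tA : trivIset setT A.
Hypothesis UA : \bigcup_k A k = setT.
Hypothesis g1P : coupling mu nu g1.
Hypothesis g2P : coupling nu kap g2.

Let B k : set (X * X) := setT `*` A k.
Let C k : set (X * X) := A k `*` setT.
Let mB k : measurable (B k). Proof. exact: measurableX. Qed.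
Let mC k : measurable (C k). Proof. exact: measurableX. Qed.

(** The product of the two restrictions divided by the mass of the cell. Since [0^-1 = 0], a cell of
    [nu]-measure zero contributes the zero measure; the absolute value only packs the factor as a
    nonnegative number for [mscale]. *)
Definition glue_piece k : {measure set ((X * X) * (X * X)) -> \bar R} :=
  mscale (NngNum (normr_ge0 (fine (nu (A k)))^-1)) (mrestr g1 (mB k) \x mrestr g2 (mC k))%E.

Definition glue : {measure set ((X * X) * (X * X)) -> \bar R} := mseries glue_piece 0.

Let nuA k : (`|(fine (nu (A k)))^-1|%:E * nu (A k) = if nu (A k) == 0 then 0 else 1)%E.
Proof.
have nufin : nu (A k) \is a fin_num by exact: fin_num_measure.
have nu0 : (0 <= nu (A k))%E by [].
rewrite ger0_norm ?invr_ge0 ?fine_ge0//; case: eqP => [->|/eqP nuneq0]; first by rewrite mule0.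
rewrite -[X in (_ * X)%E]fineK// -EFinM mulVf//.
by apply: contra nuneq0 => /eqP h; rewrite -[X in X == _]fineK// h.
Qed.

(** The second factor of a piece has total mass [nu (A k)], which the scaling cancels, so [g1] is
    recovered cell by cell. A cell with [nu (A k) = 0] carries no [g1]-mass either, because the
    second marginal of [g1] is [nu]. *)
Lemma glue_fst D : measurable D -> glue (D `*` setT) = g1 D.
Proof.
move=> mD; transitivity (g1 (\bigcup_k (D `&` B k))); last first.
  rewrite -setI_bigcupr (_ : \bigcup_k B k = setT) ?setIT// -subTset => -[x y] _.
  have [k _ Aky] : (\bigcup_k A k) y by rewrite UA.
  by exists k.
rewrite measure_semi_bigcup//; last 3 first.
- by move=> k; exact: measurableI.
- apply/trivIsetP => i j _ _ ij; rewrite -subset0 => -[x y] [[_ [_ Ai]] [_ [_ Aj]]].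
  by move/trivIsetP : tA => /(_ i j I I ij); rewrite -subset0 => /(_ y); apply.
- by apply: bigcupT_measurable => k; exact: measurableI.
apply: eq_eseriesr => k _; rewrite /glue_piece /= /mscale /=.
have /= -> := @product_measure1E _ _ _ _ _ (mrestr g1 (mB k)) (mrestr g2 (mC k)) _ _ mD measurableT.
have -> : mrestr g2 (mC k) setT = nu (A k) by rewrite /mrestr setTI; apply (g2P (mA k)).1.
rewrite /mrestr [X in (_ * X)%E]muleC muleA nuA; case: ifPn; rewrite ?mul1e// => /eqP nu0.
rewrite mul0e; apply/esym/eqP; rewrite -measure_le0 -nu0 -(g1P (mA k)).2.
by apply: le_measure; rewrite ?inE//; [exact: measurableI|exact: mB].
Qed.

Lemma glue_snd D : measurable D -> glue (setT `*` D) = g2 D.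
Proof.
move=> mD; transitivity (g2 (\bigcup_k (D `&` C k))); last first.
  rewrite -setI_bigcupr (_ : \bigcup_k C k = setT) ?setIT// -subTset => -[x y] _.
  have [k _ Aky] : (\bigcup_k A k) x by rewrite UA.
  by exists k.
rewrite measure_semi_bigcup//; last 3 first.
- by move=> k; exact: measurableI.
- apply/trivIsetP => i j _ _ ij; rewrite -subset0 => -[x y] [[_ [Ai _]] [_ [Aj _]]].
  by move/trivIsetP : tA => /(_ i j I I ij); rewrite -subset0 => /(_ x); apply.
- by apply: bigcupT_measurable => k; exact: measurableI.
apply: eq_eseriesr => k _; rewrite /glue_piece /= /mscale /=.
have /= -> := @product_measure1E _ _ _ _ _ (mrestr g1 (mB k)) (mrestr g2 (mC k)) _ _ measurableT mD.
have -> : mrestr g1 (mB k) setT = nu (A k) by rewrite /mrestr setTI; apply (g1P (mA k)).2.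
rewrite /mrestr muleA nuA; case: ifPn; rewrite ?mul1e// => /eqP nu0.
rewrite mul0e; apply/esym/eqP; rewrite -measure_le0 -nu0 -(g2P (mA k)).1.
by apply: le_measure; rewrite ?inE//; [exact: measurableI|exact: mC].
Qed.

(** Each piece is concentrated where both middle coordinates lie in [A k]; [D] is therefore covered
    by two strips that are null for that piece. *)
Lemma glue_middle D : measurable D ->
  (forall k x y y' z, A k y -> A k y' -> ~ D ((x, y), (y', z))) -> glue D = 0%E.
Proof.
move=> mD AD; rewrite /glue /= /mseries eseries0// => k _ _.
rewrite /glue_piece /= /mscale /= (_ : (_ \x _)%E D = 0%E) ?mule0//.
pose m1 : {measure set (X * X) -> \bar R} := mrestr g1 (mB k).
pose m2 : {sigma_finite_measure set (X * X)%type -> \bar R} := mrestr g2 (mC k).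
pose m12 : {measure set ((X * X) * (X * X)) -> \bar R} := (m1 \x m2)%E.
have mBC : measurable (~` B k `*` (setT : set (X * X))) by apply: measurableX => //; exact: measurableC.
have mCC : measurable ((setT : set (X * X)) `*` ~` C k) by apply: measurableX => //; exact: measurableC.
have m1B : m1 (~` B k) = 0%E by rewrite /m1 /= /mrestr setICl measure0.
have m2C : m2 (~` C k) = 0%E by rewrite /m2 /= /mrestr setICl measure0.
apply/eqP; rewrite -[_ == _]/(m12 D == 0%E) -measure_le0.
apply: (@le_trans _ _ (m12 (~` B k `*` setT `|` setT `*` ~` C k))).
  apply: le_measure; rewrite ?inE//; first exact: measurableU.
  move=> [[x y] [y' z]] Dw; apply: contrapT => /not_orP[h1 h2].
  apply: (AD k x y y' z) => //; apply: contrapT => nA.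
  - by apply: h1; split => // -[].
  - by apply: h2; split => // -[].
apply: (le_trans (measureU2 _ _ _)) => //.
rewrite /m12 /= !product_measure1E//=; try exact: measurableC.
by rewrite m1B m2C mule0 mul0e adde0.
Qed.

End Gluing.

Lemma bounded_integrable {R : realType} {d} {T : measurableType d} (mu : probability T R)
  (f : T -> R) (M : R) :
  measurable_fun setT f -> (forall x, `|f x| <= M) -> mu.-integrable setT (EFin \o f).
Proof.
move=> mf fM; apply: (@le_integrable _ _ _ _ _ _ _ (EFin \o cst M)) => //.
- exact/measurable_EFinP.
- by move=> z _ /=; rewrite lee_fin (le_trans (fM z)) ?ler_norm.
- exact: finite_measure_integrable_cst.
Qed.

(** A bridge between costs, which carry no root, and [Lnorm], in which Minkowski's inequality is
    stated. *)
Lemma Lnorm_le_powR {R : realType} {d} {T : measurableType d} (m : {measure set T -> \bar R})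
  (f : T -> R) (p c : R) : 0 < p -> 0 <= c -> (forall x, 0 <= f x) ->
  ('N[m]_p%:E[EFin \o f] <= c%:E)%E = (\int[m]_x (f x `^ p)%:E <= (c `^ p)%:E)%E.
Proof.
move=> p0 c0 f0.
have -> : (\int[m]_x (f x `^ p)%:E = 'N[m]_p%:E[EFin \o f] `^ p)%E.
  rewrite poweR_Lnorm ?gt_eqF//; apply: eq_integral => x _ /=.
  by rewrite ger0_norm.
apply/idP/idP => h.
  rewrite -poweR_EFin; apply: gt0_ler_poweR => //; rewrite ?ltW//.
    by rewrite in_itv/= leey andbT Lnorm_ge0.
  by rewrite in_itv/= leey andbT lee_fin.
have -> : c%:E = ((c `^ p)%:E `^ p^-1)%E.
  by rewrite poweR_EFin -powRrM mulfV ?gt_eqF// powRr1.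
have -> : 'N[m]_p%:E[EFin \o f]%E = (('N[m]_p%:E[EFin \o f] `^ p) `^ p^-1)%E.
  by rewrite -poweRrM mulfV ?gt_eqF// poweRe1// Lnorm_ge0.
apply: gt0_ler_poweR => //; rewrite ?invr_ge0 ?ltW//.
  by rewrite in_itv/= leey andbT poweR_ge0.
by rewrite in_itv/= leey andbT lee_fin powR_ge0.
Qed.

(** * Finite-cost couplings and the pseudometric properties of the Wasserstein distance *)

Section Wasserstein.
Context {R : realType} {d : measure_display} {X : measurableType d}.
Context (dX : X -> X -> R) (dX_polish : polish_metric dX) (dX_borel : borel_sigma dX).
Context (p : R) (p1 : 1 < p).

Let dX_ge0 x y : 0 <= dX x y := polish_ge0 dX_polish x y.
Let dXxx x : dX x x = 0 := polish_refl dX_polish x.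
Let dXC x y : dX x y = dX y x := polish_sym dX_polish x y.
Let dX_tri y x z : dX x z <= dX x y + dX y z := polish_triangle dX_polish y x z.
Let mdX := measurable_dist dX_polish dX_borel.
Let p0 : 0 < p. Proof. exact: lt_trans p1. Qed.

Definition pcost (g : probability (X * X)%type R) : \bar R :=
  (\int[g]_z ((dX z.1 z.2) `^ p)%:E)%E.

Lemma pcost_ge0 g : (0 <= pcost g)%E.
Proof. by apply: integral_ge0 => z _; rewrite lee_fin powR_ge0. Qed.

(** The triangle inequality up to [e]: under the glued measure the outer distance is at most
    [f1 + f2 + e] almost everywhere, and Minkowski's inequality is applied twice. The reals [a] and
    [b] bound the p-th roots of the costs. *)
Lemma coupling_glue (mu nu kap : probability X R) g1 g2 (a b e : R) :
  0 <= a -> 0 <= b -> 0 < e -> coupling mu nu g1 -> coupling nu kap g2 ->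
  (pcost g1 <= (a `^ p)%:E)%E -> (pcost g2 <= (b `^ p)%:E)%E ->
  exists2 g, coupling mu kap g & (pcost g <= ((a + b + e) `^ p)%:E)%E.
Proof.
move=> a0 b0 e0 g1P g2P g1a g2b.
have [A [mA tA UA Ae]] := small_partition dX_polish dX_borel e0.
have GT : glue nu g1 g2 mA setT = 1%E.
  by rewrite -setXTT (glue_fst mA tA UA g1P g2P measurableT) probability_setT.
pose G : probability ((X * X) * (X * X))%type R :=
  HB.pack (Measure.sort (glue nu g1 g2 mA)) (Measure_isProbability.Build _ _ _ (glue nu g1 g2 mA) GT).
have mh : measurable_fun setT (fun w : (X * X) * (X * X) => (w.1.1, w.2.2)).
  apply: measurable_fun_pair.
    exact: (measurableT_comp measurable_fst).
  exact: (measurableT_comp measurable_snd).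
pose h : {mfun ((X * X) * (X * X))%type >-> (X * X)%type} := HB.pack (fun w : (X * X) * (X * X) => (w.1.1, w.2.2)) (isMeasurableFun.Build _ _ _ _ _ mh).
exists (distribution G h).
  move=> S mS; split.
    have := glue_fst mA tA UA g1P g2P (measurableX mS measurableT).
    rewrite (g1P S mS).1 => <-; congr (glue _ _ _ _ _).
    by apply/seteqP; split => -[[? ?] [? ?]] /=; tauto.
  have := glue_snd mA tA UA g1P g2P (measurableX measurableT mS).
  rewrite (g2P S mS).2 => <-; congr (glue _ _ _ _ _).
  by apply/seteqP; split => -[[? ?] [? ?]] /=; tauto.
rewrite /pcost ge0_integral_distribution//; last 2 first.
- by apply/measurable_EFinP; exact: measurable_dist_powR.
- by move=> y; rewrite lee_fin powR_ge0.
pose f (w : (X * X) * (X * X)) := dX w.1.1 w.2.2.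
pose f1 (w : (X * X) * (X * X)) := dX w.1.1 w.1.2.
pose f2 (w : (X * X) * (X * X)) := dX w.2.1 w.2.2.
have mf : measurable_fun setT f by exact: (measurableT_comp mdX mh).
have mf1 : measurable_fun setT f1 by exact: (measurableT_comp mdX measurable_fst).
have mf2 : measurable_fun setT f2 by exact: (measurableT_comp mdX measurable_snd).
have mmid : measurable_fun setT (fun w : (X * X) * (X * X) => dX w.1.2 w.2.1).
  apply: (measurableT_comp mdX (g := fun w : (X * X) * (X * X) => (w.1.2, w.2.1))).
  apply: measurable_fun_pair.
    exact: (measurableT_comp measurable_snd).
  exact: (measurableT_comp measurable_fst).
have If1 : (\int[G]_w (f1 w `^ p)%:E = pcost g1)%E.
  pose q : {mfun ((X * X) * (X * X))%type >-> (X * X)%type} :=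
    HB.pack (@fst (X * X)%type (X * X)%type) (isMeasurableFun.Build _ _ _ _ _ measurable_fst).
  rewrite /pcost -(@eq_measure_integral _ _ _ _ g1 (distribution G q)); last first.
    move=> S mS _; apply: etrans (glue_fst mA tA UA g1P g2P mS); congr (glue _ _ _ _ _).
    by apply/seteqP; split => -[[? ?] [? ?]] /=; tauto.
  rewrite ge0_integral_distribution//.
  - by apply/measurable_EFinP; exact: measurable_dist_powR.
  - by move=> y; rewrite lee_fin powR_ge0.
have If2 : (\int[G]_w (f2 w `^ p)%:E = pcost g2)%E.
  pose q : {mfun ((X * X) * (X * X))%type >-> (X * X)%type} :=
    HB.pack (@snd (X * X)%type (X * X)%type) (isMeasurableFun.Build _ _ _ _ _ measurable_snd).
  rewrite /pcost -(@eq_measure_integral _ _ _ _ g2 (distribution G q)); last first.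
    move=> S mS _; apply: etrans (glue_snd mA tA UA g1P g2P mS); congr (glue _ _ _ _ _).
    by apply/seteqP; split => -[[? ?] [? ?]] /=; tauto.
  rewrite ge0_integral_distribution//.
  - by apply/measurable_EFinP; exact: measurable_dist_powR.
  - by move=> y; rewrite lee_fin powR_ge0.
have mmidS : measurable [set w : (X * X) * (X * X) | e <= dX w.1.2 w.2.1].
  rewrite (_ : mkset _ = setT `&` (fun w : (X * X) * (X * X) => dX w.1.2 w.2.1) @^-1` `[e, +oo[).
    by apply: mmid.
  by rewrite setTI; apply/seteqP; split => w /=; rewrite in_itv/= andbT.
have mid : G [set w | e <= dX w.1.2 w.2.1] = 0%E.
  apply: (glue_middle _ _ _ mA _) => //.
  by move=> k x y y' z Ay Ay' /=; rewrite leNgt (Ae k).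
apply: (@le_trans _ _ (\int[G]_w ((f1 w + (f2 w + e)) `^ p)%:E)%E).
  apply: ae_ge0_le_integral => //.
  - by move=> w _; rewrite lee_fin powR_ge0.
  - apply/measurable_EFinP; exact: (measurableT_comp (measurable_powR _)).
  - by move=> w _; rewrite lee_fin powR_ge0.
  - apply/measurable_EFinP; apply: (measurableT_comp (measurable_powR _)).
    by apply: measurable_funD => //; apply: measurable_funD.
  (* The pointwise comparison can fail only where the middle coordinates are at least [e] apart. *)
  exists [set w | e <= dX w.1.2 w.2.1]; split => //.
  move=> [[x y] [y' z]] h1 /=; rewrite leNgt; apply/negP => h2; apply: h1 => _ /=.
  have e0' := ltW e0.
  rewrite lee_fin /f /f1 /f2 /=; apply: ge0_ler_powR; rewrite ?nnegrE ?addr_ge0//.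
    exact: ltW.
  by have := dX_tri y x z; have := dX_tri y' y z; move: h2 => /=; lra.
have e0' := ltW e0.
have f12_ge0 w : 0 <= f1 w + (f2 w + e) by rewrite !addr_ge0// ?dX_ge0.
rewrite -(@Lnorm_le_powR _ _ _ G (fun w => f1 w + (f2 w + e)) p (a + b + e)) ?addr_ge0//.
apply: (@le_trans _ _ ('N[G]_p%:E[EFin \o f1] + 'N[G]_p%:E[EFin \o (f2 \+ cst e)%R])%E).
  by apply: (@minkowski_EFin _ _ _ G f1 (f2 \+ cst e)%R p) => //; rewrite ?ltW//; exact: measurable_funD.
rewrite -addrA EFinD; apply: leeD.
  by rewrite Lnorm_le_powR ?If1// => w; exact: dX_ge0.
apply: (@le_trans _ _ ('N[G]_p%:E[EFin \o f2] + 'N[G]_p%:E[EFin \o cst e])%E).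
  by apply: (@minkowski_EFin _ _ _ G f2 (cst e)%R p) => //; rewrite ltW.
rewrite EFinD; apply: leeD.
  by rewrite Lnorm_le_powR ?If2// => w; exact: dX_ge0.
by rewrite Lnorm_le_powR//= integral_cst// [X in (_ * X)%E](_ : _ = 1%E) ?mule1.
Qed.

Lemma pcost_distribution (mu : probability X R) (h : {mfun X >-> (X * X)%type}) :
  pcost (distribution mu h) = (\int[mu]_x (dX (h x).1 (h x).2 `^ p)%:E)%E.
Proof.
rewrite /pcost ge0_integral_distribution// => [|y].
  by apply/measurable_EFinP; exact: measurable_dist_powR.
by rewrite lee_fin powR_ge0.
Qed.

Lemma coupling_dirac (mu : probability X R) x0 :
  exists2 g, coupling mu (dirac x0) g & pcost g = (\int[mu]_x (dX x0 x `^ p)%:E)%E.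
Proof.
have mh : measurable_fun setT (fun x : X => (x, x0)) by exact: measurable_fun_pair.
pose h : {mfun X >-> (X * X)%type} :=
  HB.pack (fun x : X => (x, x0)) (isMeasurableFun.Build _ _ _ _ _ mh).
exists (distribution mu h); last first.
  by rewrite pcost_distribution; apply: eq_integral => x _; rewrite dXC.
move=> A mA; rewrite /distribution /pushforward; split.
  by congr (mu _); apply/seteqP; split => x //= [].
transitivity (mu (if x0 \in A then setT else set0)); last first.
  by rewrite [RHS](@diracE _ X R x0 A); case: ifP => _; rewrite ?measure0 ?probability_setT.
congr (mu _); apply/seteqP; split => x /=; first by move=> [_ /mem_set ->].
by case: ifPn => // /set_mem.
Qed.

Lemma coupling_diag (mu : probability X R) :
  exists2 g, coupling mu mu g & pcost g = 0%E.
Proof.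
have mh : measurable_fun setT (fun x : X => (x, x)) by exact: measurable_fun_pair.
pose h : {mfun X >-> (X * X)%type} :=
  HB.pack (fun x : X => (x, x)) (isMeasurableFun.Build _ _ _ _ _ mh).
exists (distribution mu h); last first.
  by rewrite pcost_distribution; apply: integral0_eq => x _ /=; rewrite dXxx powR0// gt_eqF.
move=> A mA; rewrite /distribution /pushforward; split;
  by congr (mu _); apply/seteqP; split => x //= [].
Qed.

Lemma coupling_sym (mu nu : probability X R) g : coupling mu nu g ->
  exists2 g', coupling nu mu g' & pcost g' = pcost g.
Proof.
move=> gP.
have mh : measurable_fun setT (fun z : X * X => (z.2, z.1)).
  exact: (measurable_fun_pair measurable_snd measurable_fst).
pose h : {mfun (X * X)%type >-> (X * X)%type} :=
  HB.pack (fun z : X * X => (z.2, z.1)) (isMeasurableFun.Build _ _ _ _ _ mh).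
exists (distribution g h); last first.
  rewrite /pcost ge0_integral_distribution//.
  - by apply: eq_integral => z _ /=; rewrite dXC.
  - by apply/measurable_EFinP; exact: measurable_dist_powR.
  - by move=> y; rewrite lee_fin powR_ge0.
move=> A mA; rewrite /distribution /pushforward; split.
  rewrite -(gP A mA).2; congr (g _); apply/seteqP; split => -[? ?] /=; tauto.
by rewrite -(gP A mA).1; congr (g _); apply/seteqP; split => -[? ?] /=; tauto.
Qed.

Let powRK (a : R) : 0 <= a -> (a `^ p^-1) `^ p = a.
Proof. by move=> a0; rewrite -powRrM mulVf ?gt_eqF// powRr1. Qed.

Let powRKV (a : R) : 0 <= a -> (a `^ p) `^ p^-1 = a.
Proof. by move=> a0; rewrite -powRrM mulfV ?gt_eqF// powRr1. Qed.

Let pcost_lty_powR g : (pcost g < +oo)%E -> exists2 a, 0 <= a & (pcost g <= (a `^ p)%:E)%E.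
Proof.
move=> glty; exists (fine (pcost g) `^ p^-1); rewrite ?powR_ge0//.
by rewrite powRK ?fine_ge0 ?pcost_ge0// fineK// ge0_fin_numE ?pcost_ge0.
Qed.

(** [fine] sends [+oo] to 0, so [Wp] has its meaning only once some coupling has finite cost. One is
    glued along [mu], [dirac x0], [dirac y0], [nu], as the base points of the two moment conditions
    may differ. *)
Lemma coupling_lty (mu nu : probability X R) : Pp dX p mu -> Pp dX p nu ->
  exists2 g, coupling mu nu g & (pcost g < +oo)%E.
Proof.
move=> [x0 mux0] [y0 nuy0].
have [g1 g1P] := coupling_dirac mu x0; move: mux0 => /[swap] <- /pcost_lty_powR[a a0 g1a].
have [g3' g3P' g3E] := coupling_dirac nu y0; have [g3 g3P g3E'] := coupling_sym g3P'.
move: nuy0; rewrite -g3E -g3E' => /pcost_lty_powR[c c0 g3c].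
have [g2 g2P g2E] := coupling_dirac (dirac x0) y0.
have /pcost_lty_powR[b b0 g2b] : (pcost g2 < +oo)%E.
  rewrite g2E [X in (X < _)%E](@integral_dirac _ X x0 R setT); last 2 first.
  - exact: measurableT.
  - apply/measurable_EFinP; apply: (measurableT_comp (measurable_powR _)).
    exact: (measurableT_comp mdX (measurable_pair1 y0)).
  by rewrite diracT mul1e ltry.
have [g12 g12P g12c] := coupling_glue a0 b0 ltr01 g1P g2P g1a g2b.
have [|g gP gc] := coupling_glue _ c0 ltr01 g12P g3P g12c g3c.
  by rewrite !addr_ge0.
by exists g => //; rewrite (le_lt_trans gc)// ltry.
Qed.

Let W := Wp dX p.
Let inf_cost (mu nu : probability X R) := ereal_inf (pcost @` coupling mu nu).

Let inf_cost_ge0 mu nu : (0 <= inf_cost mu nu)%E.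
Proof. by apply: le_ereal_inf_tmp => _ [g _ <-]; exact: pcost_ge0. Qed.

Lemma Wp_ge0 mu nu : 0 <= W mu nu.
Proof. exact: powR_ge0. Qed.

Lemma Wp_coupling mu nu e : Pp dX p mu -> Pp dX p nu -> 0 < e ->
  exists2 g, coupling mu nu g & (pcost g <= ((W mu nu + e) `^ p)%:E)%E.
Proof.
move=> Pmu Pnu e0; have [g0 g0P g0lty] := coupling_lty Pmu Pnu.
have inf_fin : inf_cost mu nu \is a fin_num.
  rewrite ge0_fin_numE// (le_lt_trans _ g0lty)//.
  by apply: ereal_inf_lbound; exists g0.
have : (inf_cost mu nu < ((W mu nu + e) `^ p)%:E)%E.
  rewrite -(fineK inf_fin) lte_fin -[X in X < _]powRK ?fine_ge0//.
  apply: gt0_ltr_powR => //; rewrite ?nnegrE ?powR_ge0 ?addr_ge0 ?powR_ge0 ?ltW//.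
  by rewrite /W /Wp ltrDl.
by move=> /ereal_inf_lt[_ [g gP <-]] gW; exists g => //; exact: ltW.
Qed.

Lemma Wp_le mu nu g c : coupling mu nu g -> 0 <= c ->
  (pcost g <= (c `^ p)%:E)%E -> W mu nu <= c.
Proof.
move=> gP c0 gc; have infc : (inf_cost mu nu <= (c `^ p)%:E)%E.
  by apply: le_trans gc; apply: ereal_inf_lbound; exists g.
rewrite /W /Wp -[leRHS](powRKV c0).
have p0' := ltW p0.
have inf0 : 0 <= fine (inf_cost mu nu) by rewrite fine_ge0.
apply: ge0_ler_powR; rewrite ?nnegrE ?invr_ge0 ?powR_ge0//.
have inf_fin : inf_cost mu nu \is a fin_num.
  by rewrite ge0_fin_numE ?inf_cost_ge0// (le_lt_trans infc)// ltry.
by rewrite -lee_fin (fineK inf_fin).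
Qed.

Lemma Wpxx mu : W mu mu = 0.
Proof.
have [g gP g0] := coupling_diag mu; apply/eqP; rewrite eq_le Wp_ge0 andbT.
by apply: (Wp_le gP) => //; rewrite g0 powR0// gt_eqF.
Qed.

Lemma Wp_sym mu nu : Pp dX p mu -> Pp dX p nu -> W mu nu = W nu mu.
Proof.
wlog suff : mu nu / Pp dX p mu -> Pp dX p nu -> W mu nu <= W nu mu.
  by move=> h Pmu Pnu; apply/le_anti; rewrite !h.
move=> Pmu Pnu; apply/ler_addgt0Pr => e e0.
have [g /coupling_sym[g' g'P g'g] gW] := Wp_coupling Pnu Pmu e0.
by apply: (Wp_le g'P); [exact: addr_ge0 (Wp_ge0 _ _) (ltW e0)|rewrite g'g].
Qed.

Lemma Wp_triangle nu mu kap : Pp dX p mu -> Pp dX p nu -> Pp dX p kap ->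
  W mu kap <= W mu nu + W nu kap.
Proof.
move=> Pmu Pnu Pkap; apply/ler_addgt0Pr => e e0.
have e30 : 0 < e / 3 by rewrite divr_gt0.
have [g1 g1P g1W] := Wp_coupling Pmu Pnu e30.
have [g2 g2P g2W] := Wp_coupling Pnu Pkap e30.
have W1 : 0 <= W mu nu + e / 3 by rewrite addr_ge0 ?Wp_ge0 ?ltW.
have W2 : 0 <= W nu kap + e / 3 by rewrite addr_ge0 ?Wp_ge0 ?ltW.
have [g gP gW] := coupling_glue W1 W2 e30 g1P g2P g1W g2W.
have -> : W mu nu + W nu kap + e = W mu nu + e / 3 + (W nu kap + e / 3) + e / 3 by field.
by apply: (Wp_le gP) => //; exact: addr_ge0 (addr_ge0 W1 W2) (ltW e30).
Qed.

Lemma measurable_dcontinuous (phi : X -> R) :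
  (forall x (e : R), 0 < e -> exists2 del : R, 0 < del &
     forall y, dX x y < del -> `|phi x - phi y| < e) -> measurable_fun setT phi.
Proof.
move=> phiC; apply: (@measurability _ _ _ _ _ _ (@RGenInftyO.G R)).
  exact: RGenInftyO.measurableE.
move=> _ [_ [r ->] <-]; rewrite setTI dX_borel; apply: sub_sigma_algebra.
move=> x /=; rewrite in_itv/= => xr.
have [del del0 phidel] := phiC x (r - phi x) ltac:(by rewrite subr_gt0).
exists del => // y /phidel; rewrite ltr_distlC => /andP[_].
by rewrite subrKC /= in_itv.
Qed.

Lemma lipschitz_dcontinuous (phi : X -> R) (L : R) :
  (forall x y, `|phi x - phi y| <= L * dX x y) ->
  forall x (e : R), 0 < e -> exists2 del : R, 0 < del &
     forall y, dX x y < del -> `|phi x - phi y| < e.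
Proof.
move=> phiL x e e0; have L1 : 0 < `|L| + 1 by rewrite ltr_wpDl.
exists (e / (`|L| + 1)) => [|y xy]; first exact: divr_gt0.
rewrite ltr_pdivlMr// in xy; apply: le_lt_trans xy; apply: le_trans (phiL x y) _.
by rewrite mulrC ler_wpM2l// (le_trans (ler_norm L))// lerDl.
Qed.

(** For [a > del], write [a = a^(1-p) * a^p] and use that [1 - p] is negative. *)
Lemma le_add_powR (del a : R) : 0 < del -> 0 <= a -> a <= del + del `^ (1 - p) * a `^ p.
Proof.
move=> del0 a0; have [adel|dela] := leP a del.
  by rewrite (le_trans adel)// lerDl mulr_ge0 ?powR_ge0.
rewrite (@le_trans _ _ (del `^ (1 - p) * a `^ p))//; last by rewrite lerDr ltW.
have a0' : 0 < a := lt_trans del0 dela.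
rewrite -(mulr_powRB1 a0 p0) mulrCA ler_peMr//.
rewrite -(opprB p 1) powRN mulrC -ler_pdivrMr ?invr_gt0 ?powR_gt0//.
rewrite div1r invrK; apply: ge0_ler_powR; rewrite ?nnegrE ?subr_ge0; exact: ltW.
Qed.

(** An almost optimal coupling leaves the integral of the distance, which [le_add_powR] compares
    with the cost. The choice [del = w] turns the bound into [2 * L * w]. *)
Lemma Wp_lipschitz (mu nu : probability X R) (phi : X -> R) (M L del w : R) :
  Pp dX p mu -> Pp dX p nu -> 0 <= L -> 0 < del ->
  (forall x, `|phi x| <= M) -> (forall x y, `|phi x - phi y| <= L * dX x y) ->
  W mu nu < w ->
  (`|\int[mu]_x (phi x)%:E - \int[nu]_x (phi x)%:E|
     <= (L * (del + del `^ (1 - p) * w `^ p))%:E)%E.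
Proof.
move=> Pmu Pnu L0 del0 phiM phiL Ww.
have [g gP] := Wp_coupling Pmu Pnu (ltac:(by rewrite subr_gt0) : 0 < w - W mu nu).
rewrite subrKC => gw.
have mphi := measurable_dcontinuous (lipschitz_dcontinuous phiL).
have mphi1 : measurable_fun setT (fun z : X * X => phi z.1) by exact: measurableT_comp.
have mphi2 : measurable_fun setT (fun z : X * X => phi z.2) by exact: measurableT_comp.
have Imu : (\int[mu]_x (phi x)%:E = \int[g]_z (phi z.1)%:E)%E.
  pose q : {mfun (X * X)%type >-> X} :=
    HB.pack (@fst X X) (isMeasurableFun.Build _ _ _ _ _ measurable_fst).
  rewrite -(@eq_measure_integral _ _ _ _ mu (distribution g q)); last first.
    move=> S mS _; transitivity (g (S `*` setT)); last exact: (gP S mS).1.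
    rewrite (_ : S `*` setT = q @^-1` S)//.
    by apply/seteqP; split => -[? ?] //= -[].
  by rewrite integral_distribution//; [exact/measurable_EFinP|exact: bounded_integrable mphi1 (fun z => phiM z.1)].
have Inu : (\int[nu]_x (phi x)%:E = \int[g]_z (phi z.2)%:E)%E.
  pose q : {mfun (X * X)%type >-> X} :=
    HB.pack (@snd X X) (isMeasurableFun.Build _ _ _ _ _ measurable_snd).
  rewrite -(@eq_measure_integral _ _ _ _ nu (distribution g q)); last first.
    move=> S mS _; transitivity (g (setT `*` S)); last exact: (gP S mS).2.
    rewrite (_ : setT `*` S = q @^-1` S)//.
    by apply/seteqP; split => -[? ?] //= -[].
  by rewrite integral_distribution//; [exact/measurable_EFinP|exact: bounded_integrable mphi2 (fun z => phiM z.2)].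
rewrite Imu Inu -integralB_EFin//; [|exact: bounded_integrable mphi1 (fun z => phiM z.1)|
  exact: bounded_integrable mphi2 (fun z => phiM z.2)].
apply: le_trans (le_abse_integral _ _ _) _ => //.
  by apply/measurable_EFinP; exact: measurable_funB.
have mdp := measurable_dist_powR dX_polish dX_borel p.
apply: (@le_trans _ _ (\int[g]_z (L%:E * (del%:E + (del `^ (1 - p))%:E * (dX z.1 z.2 `^ p)%:E)))%E).
  apply: ge0_le_integral => //.
  - by apply/measurable_EFinP; apply: measurableT_comp => //; exact: measurable_funB.
  - by apply/measurable_EFinP; apply: measurable_funM => //; apply: measurable_funD => //; exact: measurable_funM.
  - move=> z _; rewrite [leLHS]/= [leRHS]/= lee_fin (le_trans (phiL _ _))//.
    by rewrite ler_wpM2l// le_add_powR.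
rewrite ge0_integralZl//; last 2 first.
- exact/(measurable_EFinP _ (fun z => del + del `^ (1 - p) * dX z.1 z.2 `^ p))/measurable_funD/measurable_funM.
- by move=> z _; rewrite [leRHS]/= lee_fin addr_ge0 ?mulr_ge0 ?powR_ge0// ltW.
rewrite ge0_integralD//; last 3 first.
- by move=> z _; rewrite lee_fin ltW.
- by move=> z _; rewrite [leRHS]/= lee_fin mulr_ge0 ?powR_ge0.
- exact/(measurable_EFinP _ (fun z => del `^ (1 - p) * dX z.1 z.2 `^ p))/measurable_funM.
rewrite EFinM lee_wpmul2l ?lee_fin// EFinD integral_cst// EFinM.
rewrite [X in (_ * X + _)%E](_ : _ = 1%E) ?mule1; last exact: probability_setT.
rewrite leeD2l// ge0_integralZl//.
- by rewrite lee_wpmul2l// lee_fin powR_ge0.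
- exact/measurable_EFinP.
- by move=> z _; rewrite lee_fin powR_ge0.
- by rewrite lee_fin powR_ge0.
Qed.

End Wasserstein.

(** * Absolutely continuous functions and the metric derivative *)

Section AbsolutelyContinuous.
Context {R : realType}.
Local Notation leb := (@lebesgue_measure R).
Implicit Types (f m k h : R -> R).

Lemma integral_itv_small m (e : R) :
  leb.-integrable setT (EFin \o m) -> 0 < e ->
  exists2 del : R, 0 < del & forall s t, s <= t -> t - s < del ->
    `|\int[leb]_(x in `]s, t]) m x| < e.
Proof.
move=> intm e0; have [del [del0 small]] := integral_normr_continuous intm e0.
exists del => // s t st tsdel.
have lst : (leb `]s, t]%classic < del%:E)%E.
  by rewrite lebesgue_measure_itv/=; case: ifPn => _; rewrite ?lte_fin// -EFinD lte_fin.
apply: le_lt_trans (small _ (measurable_itv _) lst).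
by apply: le_normr_Rintegral => //; exact: integrableS intm.
Qed.

Lemma EFin_Rintegral (A : set R) m : measurable A ->
  leb.-integrable setT (EFin \o m) ->
  ((\int[leb]_(x in A) m x)%:E = \int[leb]_(x in A) (m x)%:E)%E.
Proof.
move=> mA intm; rewrite /Rintegral fineK//; apply: integrable_fin_num => //.
exact: integrableS intm.
Qed.

Lemma stieltjes_itv (h : cumulative R R) (s t : R) : s <= t ->
  lebesgue_stieltjes_measure h `]s, t]%classic = (h t - h s)%:E.
Proof.
move=> st; rewrite /lebesgue_stieltjes_measure/= /measure_extension/=.
rewrite measurable_mu_extE//=; last exact: is_ocitv.
by rewrite wlength_itv_bnd.
Qed.

(** Domination by the integral of [m] gives the right continuity that a Stieltjes measure
    requires. *)
Lemma ac_cumulative h m :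
  leb.-integrable setT (EFin \o m) ->
  (forall s t, s <= t -> 0 <= h t - h s <= \int[leb]_(x in `]s, t]) m x) ->
  exists H : cumulative R R, forall x, H x = h x.
Proof.
move=> intm hm.
have hnd : nondecreasing h.
  by move=> s t st; have /andP[+ _] := hm _ _ st; rewrite subr_ge0.
have hrc : right_continuous h.
  move=> x; apply/cvgrPdist_lt => e e0.
  have [del del0 small] := integral_itv_small intm e0.
  near=> y.
  have xy : x < y by near: y; exact: nbhs_right_gt.
  have /andP[h0 hle] := hm _ _ (ltW xy).
  rewrite distrC (ger0_norm h0) (le_lt_trans hle)// (le_lt_trans (ler_norm _))//.
  apply: small; first exact: ltW.
  by rewrite ltrBlDl; near: y; apply: nbhs_right_lt; rewrite ltrDl.
pose H : cumulative R R := HB.pack h (isCumulative.Build R _ R h hnd hrc).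
by exists H.
Unshelve. all: by end_near. Qed.

(* With [M] a primitive of [m], the Stieltjes measures of [h] and [M - h] add up to
   that of [M], which is [m] times the Lebesgue measure. *)
Lemma stieltjes_le_integral (h m : R -> R) (H : cumulative R R) :
  (forall x, 0 <= m x) -> leb.-integrable setT (EFin \o m) ->
  (forall x, H x = h x) ->
  (forall s t, s <= t -> 0 <= h t - h s <= \int[leb]_(x in `]s, t]) m x) ->
  forall A : set R, measurable A ->
    (lebesgue_stieltjes_measure H A <= \int[leb]_(x in A) (m x)%:E)%E.
Proof.
move=> m0 intm Hh hm.
pose M t := \int[leb]_(x in `]-oo, t]) m x.
have ME s t : s <= t -> M t - M s = \int[leb]_(x in `]s, t]) m x.
  move=> st; rewrite /M Rintegral_itvB//.
  exact: integrableS intm.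
have [H' H'E] : exists H' : cumulative R R, forall x, H' x = M x - h x.
  apply: (ac_cumulative intm) => s t st.
  have /andP[h0 hle] := hm _ _ st.
  by rewrite -(ME _ _ st) in hle *; apply/andP; split; lra.
have [HM HME] : exists H' : cumulative R R, forall x, H' x = M x.
  apply: (ac_cumulative intm) => s t st.
  by rewrite ME// lexx andbT; apply: Rintegral_ge0.
have mm : measurable_fun setT (EFin \o m) by exact: measurable_int intm.
have mm0 x : (0 <= (EFin \o m) x)%E by rewrite lee_fin.
pose nu0 (A : set (measurableTypeR R)) := (\int[leb]_(x in A) (EFin \o m) x)%E.
have nu00 : nu0 set0 = 0%E by exact: integral_set0.
have nu0_ge0 A : (0 <= nu0 A)%E by exact: integral_ge0.
have nu0_add : semi_sigma_additive nu0 by exact: semi_sigma_additive_nng_induced.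
pose nu : {measure set (measurableTypeR R) -> \bar R} :=
  HB.pack nu0 (isMeasure.Build _ (measurableTypeR R) R nu0 nu00 nu0_ge0 nu0_add).
(* A Stieltjes measure is determined by its values on half-open intervals. This is used for [m]
   times Lebesgue measure and for the sum of the measures of [h] and [M - h]. *)
have itv_measure (n1 : {measure set (measurableTypeR R) -> \bar R}) :
    (forall s t, s <= t -> n1 `]s, t]%classic = (M t - M s)%:E) ->
    forall A : set R, measurable A -> lebesgue_stieltjes_measure HM A = n1 A.
  move=> n1E; apply: lebesgue_stieltjes_measure_unique => _ [[s t] _ <-] /=.
  have [st|ts] := leP s t; first by rewrite n1E// stieltjes_itv// !HME.
  by rewrite set_itv_ge ?measure0// bnd_simp -leNgt ltW.
move=> A mA.
have <- : lebesgue_stieltjes_measure HM A = (\int[leb]_(x in A) (m x)%:E)%E.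
  apply: (itv_measure nu) => // s t st.
  by rewrite ME// EFin_Rintegral.
pose n1 : {measure set (measurableTypeR R) -> \bar R} := lebesgue_stieltjes_measure H.
pose n2 : {measure set (measurableTypeR R) -> \bar R} := lebesgue_stieltjes_measure H'.
have n12 (B : set R) : measure_add n1 n2 B = (n1 B + n2 B)%E by exact: measure_addE.
have -> : lebesgue_stieltjes_measure HM A = measure_add n1 n2 A.
  apply: itv_measure => // s t st; apply: (etrans (n12 _)).
  apply: (etrans (congr2 adde (stieltjes_itv H st) (stieltjes_itv H' st))).
  by rewrite [LHS]/= !Hh !H'E; congr EFin; ring.
by rewrite [leRHS](n12 A) leeDl.
Qed.

(** By the domination, the Stieltjes measure of [h] is finite and absolutely continuous, so
    Radon-Nikodym supplies the density. *)
Lemma monotone_ac_density h m :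
  (forall x, 0 <= m x) -> leb.-integrable setT (EFin \o m) ->
  (forall s t, s <= t -> 0 <= h t - h s <= \int[leb]_(x in `]s, t]) m x) ->
  exists2 k, leb.-integrable setT (EFin \o k) &
    forall s t, s <= t -> h t - h s = \int[leb]_(x in `]s, t]) k x.
Proof.
move=> m0 intm hm; have [H HE] := ac_cumulative intm hm.
have Hm := stieltjes_le_integral m0 intm HE hm.
have Hfin : fin_num_fun (lebesgue_stieltjes_measure H).
  move=> A mA; rewrite ge0_fin_numE// (le_lt_trans (Hm _ mA))//.
  apply: integrable_lty => //; exact: integrableS intm.
pose nu : {finite_measure set (measurableTypeR R) -> \bar R} :=
  HB.pack (lebesgue_stieltjes_measure H)
    (Measure_isFinite.Build _ _ _ (lebesgue_stieltjes_measure H) Hfin).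
have nu_leb : nu `<< leb.
  apply/null_content_dominatesP => A mA A0; apply/eqP.
  rewrite -measure_le0 (le_trans (Hm _ mA))// null_set_integral//.
  by apply: measurable_funTS; exact: measurable_int intm.
have [k [k0 kfin intk kE]] := radon_nikodym_sigma_finite nu_leb.
have kK : EFin \o (fine \o k) = k by apply/funext => x /=; rewrite fineK.
exists (fine \o k); first by rewrite kK.
move=> s t st; apply: EFin_inj; rewrite EFin_Rintegral//; last by rewrite kK.
rewrite -!HE -stieltjes_itv//.
rewrite [LHS](kE _ (measurable_itv _)).
by apply: eq_integral => x _; rewrite /= fineK.
Qed.

(** Adding to [f] the primitive [M] of [m] gives increments between 0 and twice those of [M], which
    is the monotone case; [m] is then subtracted from the density. *)
Lemma ac_density f m :
  (forall x, 0 <= m x) -> leb.-integrable setT (EFin \o m) ->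
  (forall s t, s <= t -> `|f t - f s| <= \int[leb]_(x in `]s, t]) m x) ->
  exists2 k, leb.-integrable setT (EFin \o k) &
    forall s t, s <= t -> f t - f s = \int[leb]_(x in `]s, t]) k x.
Proof.
move=> m0 intm fm.
pose M t := \int[leb]_(x in `]-oo, t]) m x.
have ME s t : s <= t -> M t - M s = \int[leb]_(x in `]s, t]) m x.
  by move=> st; rewrite /M Rintegral_itvB//; exact: integrableS intm.
have int2m : leb.-integrable setT (EFin \o (m \+ m)%R) by exact: (integrableD measurableT intm intm).
have [|s t st|k intk kE] := @monotone_ac_density (M \+ f) (m \+ m)%R _ int2m.
- by move=> x; rewrite addr_ge0.
- rewrite RintegralD//; [|exact: integrableS intm|exact: integrableS intm].
  have := fm _ _ st; rewrite -!ME//= ler_norml => /andP[h1 h2].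
  by apply/andP; split; lra.
exists (k \- m)%R; first exact: (integrableB measurableT intk intm).
move=> s t st; rewrite RintegralB//; [|exact: integrableS intk|exact: integrableS intm].
by rewrite -kE// -ME//=; ring.
Qed.

End AbsolutelyContinuous.

#[local] Instance ae_filter_lebesgue {R : realType} :
  Filter (nbhs (almost_everywhere (@lebesgue_measure R))).
Proof. exact: ae_filter_ringOfSetsType. Qed.

Section MetricDerivative.
Context {R : realType}.
Local Notation leb := (@lebesgue_measure R).
Implicit Types (f m k h g F : R -> R).

Definition slope F t s := (F s - F t) / (s - t).

Lemma slope_cvg F t : derivable F t 1 -> slope F t s @[s --> t^'] --> derive1 F t.
Proof.
move=> dF; have : h^-1 *: (F (h *: 1 + t) - F t) @[h --> 0^'] --> derive1 F t.
  by rewrite derive1E; exact: dF.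
move=> /cvgrPdist_lt Fh; apply/cvgrPdist_lt => e e0.
have [del /= del0 Fdel] := Fh e e0; exists del => //= s tsdel snet.
have := Fdel (s - t); rewrite /= sub0r normrN distrC subr_eq0 => /(_ tsdel snet).
by rewrite /slope /GRing.scale/= mulr1 subrK mulrC.
Qed.

Lemma slope_primitive k : leb.-integrable setT (EFin \o k) ->
  {ae leb, forall t, slope (fun u => \int[leb]_(x in `]-oo, u]) k x) t s @[s --> t^'] --> k t}.
Proof.
move=> intk; have intk' y : leb.-integrable `]-oo, y] (EFin \o k) by exact: integrableS intk.
have lock : locally_integrable setT k by apply: open_integrable_locally => //; exact: openT.
by apply: filterS (FTC1Ny intk' lock) => t [dF <-]; exact: slope_cvg.
Qed.

Lemma primitiveB k s t : leb.-integrable setT (EFin \o k) -> s <= t ->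
  \int[leb]_(x in `]-oo, t]) k x - \int[leb]_(x in `]-oo, s]) k x =
  \int[leb]_(x in `]s, t]) k x.
Proof. by move=> intk st; rewrite Rintegral_itvB//; exact: integrableS intk. Qed.

Lemma slope_density f k : leb.-integrable setT (EFin \o k) ->
  (forall s t, s <= t -> f t - f s = \int[leb]_(x in `]s, t]) k x) ->
  {ae leb, forall t, slope f t s @[s --> t^'] --> k t}.
Proof.
move=> intk fk; apply: filterS (slope_primitive intk) => t.
suff -> : slope (fun u => \int[leb]_(x in `]-oo, u]) k x) t = slope f t by [].
apply/funext => s; rewrite /slope; congr (_ / _).
have [st|ts] := leP t s; first by rewrite fk// primitiveB.
by rewrite -opprB -[RHS]opprB fk ?primitiveB// ltW.
Qed.

(* The derivative is the supremum of [|f_n'|] over the functions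
   [f_n t = W (q n) t], where [q] enumerates the rationals. *)
Lemma ac_pseudometric_derivative (W : R -> R -> R) m :
  (forall s t, 0 <= W s t) -> (forall t, W t t = 0) -> (forall s t, W s t = W t s) ->
  (forall r s t, W s t <= W s r + W r t) ->
  (forall x, 0 <= m x) -> leb.-integrable setT (EFin \o m) ->
  (forall s t, s <= t -> W s t <= \int[leb]_(x in `]s, t]) m x) ->
  exists g, [/\ forall x, 0 <= g x, leb.-integrable setT (EFin \o g),
    forall s t, s <= t -> W s t <= \int[leb]_(x in `]s, t]) g x &
    {ae leb, forall t, W t s / `|t - s| @[s --> t^'] --> g t}].
Proof.
move=> W0 Wtt WC Wtri m0 intm Wm.
pose q n : R := ratr (rat_enum n); pose f n t := W (q n) t.
have fW n s t : `|f n t - f n s| <= W s t.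
  have h1 := Wtri t (q n) s; have h2 := Wtri s (q n) t; rewrite (WC t s) in h1.
  by rewrite /f ler_norml; apply/andP; split; lra.
have fm n s t : s <= t -> `|f n t - f n s| <= \int[leb]_(x in `]s, t]) m x.
  by move=> st; rewrite (le_trans (fW _ _ _))// Wm.
have /choice[k kP] : forall n, exists k, leb.-integrable setT (EFin \o k) /\
    forall s t, s <= t -> f n t - f n s = \int[leb]_(x in `]s, t]) k x.
  by move=> n; have [k ? ?] := ac_density m0 intm (fm n); exists k.
have mm : measurable_fun setT m by apply/measurable_EFinP; exact: measurable_int intm.
have mk n : measurable_fun setT (k n) by apply/measurable_EFinP; exact: measurable_int (kP n).1.
(* The cap by [m] makes the supremum finite at every point; by [km] below it alters [|k n|] only on
   a null set. *)
pose u n x := Num.min `|k n x| (m x).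
have u0 n x : 0 <= u n x by rewrite le_min normr_ge0 m0.
have um n x : u n x <= m x by rewrite ge_min lexx orbT.
have uub x : has_ubound (range (u ^~ x)) by exists (m x) => _ [n _ <-].
pose g x := sups (u ^~ x) 0.
have gE x : g x = sup (range (u ^~ x)).
  by rewrite /g /sups/=; congr sup; apply/seteqP; split => _ [n _ <-]; exists n.
have ug n x : u n x <= g x by rewrite gE; apply: ub_le_sup => //; exists n.
have g0 x : 0 <= g x by exact: le_trans (ug 0%N x).
have gm x : g x <= m x.
  by rewrite gE; apply: ge_sup => [|_ [n _ <-]//]; exists (u 0%N x), 0%N.
have mu n : measurable_fun setT (u n).
  by apply: measurable_minr => //; exact: measurableT_comp.
have mg : measurable_fun setT g by apply: measurable_fun_sups.
have intg : leb.-integrable setT (EFin \o g).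
  apply: (le_integrable _ _ _ intm) => //; first exact/measurable_EFinP.
  by move=> x _ /=; rewrite lee_fin !ger0_norm.
have intu n : leb.-integrable setT (EFin \o u n).
  apply: (le_integrable _ _ _ intm) => //; first by apply/measurable_EFinP; exact: mu.
  by move=> x _ /=; rewrite lee_fin (ger0_norm (u0 n x)) (ger0_norm (m0 x)).
have slope_f n : {ae leb, forall t, slope (f n) t s @[s --> t^'] --> k n t}.
  exact: slope_density (kP n).1 (kP n).2.
have W_slope h : leb.-integrable setT (EFin \o h) ->
    (forall s t, s <= t -> W s t <= \int[leb]_(x in `]s, t]) h x) ->
    forall s t, W t s / `|t - s| <= slope (fun y => \int[leb]_(x in `]-oo, y]) h x) t s.
  move=> inth Wh s t; rewrite /slope; have [ts|st] := leP t s.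
    rewrite distrC ger0_norm ?subr_ge0// ler_wpM2r ?invr_ge0 ?subr_ge0//.
    by rewrite primitiveB// Wh.
  rewrite -[X in _ <= X / _]opprB -[X in _ <= _ / X]opprB invrN mulrNN.
  rewrite gtr0_norm ?subr_gt0// ler_wpM2r ?invr_ge0 ?subr_ge0 ?(ltW st)//.
  by rewrite (primitiveB inth (ltW st)) WC; exact: Wh (ltW st).
have f_slope n t s : `|slope (f n) t s| <= W t s / `|t - s|.
  by rewrite /slope normrM normfV (distrC t s) ler_wpM2r ?invr_ge0.
have km n : {ae leb, forall t, `|k n t| <= m t}.
  apply: filterS2 (slope_f n) (slope_primitive intm) => t /cvgrPdist_lt kt /cvgrPdist_lt mt.
  apply/ler_addgt0Pr => e e0; have e20 : 0 < e / 2 by rewrite divr_gt0.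
  near (dnbhs t) => s.
  have h1 : `|k n t - slope (f n) t s| < e / 2 by near: s; exact: kt.
  have h2 : `|m t - slope (fun y => \int[leb]_(x in `]-oo, y]) m x) t s| < e / 2.
    by near: s; exact: mt.
  have h3 := le_trans (f_slope n t s) (W_slope _ intm Wm s t).
  move: h2; rewrite ltr_distlC => /andP[_ h2].
  have := ler_distD (slope (f n) t s) (k n t) 0; rewrite !subr0; lra.
have Wg s t : s <= t -> W s t <= \int[leb]_(x in `]s, t]) g x.
  move=> st; apply/ler_addgt0Pr => e e0.
  have [del del0 small] := integral_itv_small intm (ltac:(by rewrite divr_gt0) : 0 < e / 2).
  (* A rational [q n] within [del] to the left of [s] has [W (q n) s <= e / 2], and this is paid
     twice: [W s t <= 2 * W (q n) s + (f n t - f n s)]. *)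
  have [r] := @rat_in_itvoo R (s - del) s ltac:(by rewrite ltrBlDr ltrDl).
  rewrite in_itv/= => /andP[r1 r2]; pose n := pickle r.
  have qn : q n = ratr r by rewrite /q /rat_enum pickleK.
  have Wqs : W (q n) s <= e / 2.
    rewrite (le_trans (Wm _ _ _)) ?qn ?(ltW r2)// (le_trans (ler_norm _))// ltW// small//.
      exact: ltW.
    lra.
  have fg : f n t - f n s <= \int[leb]_(x in `]s, t]) g x.
    rewrite (kP n).2// (@le_trans _ _ (\int[leb]_(x in `]s, t]) u n x))//; last first.
      apply: le_Rintegral => //; first exact: integrableS (intu n).
      exact: integrableS intg.
    rewrite (le_trans (ler_norm _))// (le_trans (le_normr_Rintegral _ _))//.
      exact: integrableS (kP n).1.
    rewrite le_eqVlt; apply/orP; left; apply/eqP; rewrite /Rintegral; congr fine.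
    apply: ae_eq_integral => //.
    - apply/measurable_EFinP/measurable_funTS.
      by apply: (measurableT_comp _ (mk n)).
    - by apply/measurable_EFinP/measurable_funTS; exact: mu.
    by apply: filterS (km n) => x kmx _ /=; rewrite /u min_l.
  have := Wtri (q n) s t; rewrite (WC s (q n)); rewrite /f in fg; lra.
exists g; split => //.
have all_slope_f : {ae leb, forall t n, slope (f n) t s @[s --> t^'] --> k n t} by exact: ae_foralln.
have all_km : {ae leb, forall t n, `|k n t| <= m t} by exact: ae_foralln.
(* The quotient of [W] is squeezed: from below by the slope of an [f n] with [|k n t|] close to
   [g t], from above by the slope of the primitive of [g]. *)
apply: filterS3 all_slope_f all_km (slope_primitive intg) => t ft kmt /cvgrPdist_lt gt.
apply/cvgrPdist_lt => e e0; have e20 : 0 < e / 2 by rewrite divr_gt0.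
have [_ [n _ <-]] := sup_adherent e20 (conj (ex_intro _ (u 0%N t) (ex_intro2 _ _ 0%N I erefl)) (uub t)).
rewrite -gE /u min_l// => gn.
have /cvgrPdist_lt fnt := ft n.
near=> s.
have h1 : `|k n t - slope (f n) t s| < e / 2 by near: s; exact: fnt.
have h2 : `|g t - slope (fun y => \int[leb]_(x in `]-oo, y]) g x) t s| < e / 2.
  by near: s; exact: gt.
have h3 := f_slope n t s.
have h4 := W_slope _ intg Wg s t.
move: h2; rewrite ltr_distlC => /andP[_ h2].
have h5 := ler_distD (slope (f n) t s) (k n t) 0; rewrite !subr0 in h5.
by rewrite ltr_distlC; apply/andP; split; lra.
Unshelve. all: by end_near. Qed.

End MetricDerivative.

(** * Integrals of derivatives of monotone functions *)

Section MonotoneDerivative.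
Context {R : realType}.
Local Notation leb := (@lebesgue_measure R).

(** Translation invariance, from uniqueness of Lebesgue measure: the image under the shift has the
    same values on half-open intervals. *)
Lemma ge0_integral_itv_shift (F : R -> R) (c a b : R) : measurable_fun setT F -> (forall x, 0 <= F x) ->
  (\int[leb]_(x in `]a, b]) (F (x + c))%:E = \int[leb]_(x in `](a + c)%R, (b + c)%R]) (F x)%:E)%E.
Proof.
move=> mF F0.
have mshift : measurable_fun setT (fun x : R => x + c) by exact: measurable_funD.
have pre s t : (fun x : R => x + c) @^-1` `](s + c), (t + c)] = `]s, t]%classic.
  by apply/seteqP; split => x /=; rewrite !in_itv/= ltrD2r lerD2r.
rewrite -[RHS](@eq_measure_integral _ _ _ _ leb (pushforward leb (fun x : R => x + c : measurableTypeR R))); last first.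
  move=> A mA _; apply/esym/lebesgue_measure_unique => //= _ [[s t]] _ <- /=.
  rewrite /pushforward -(subrK c s) -(subrK c t) pre !lebesgue_measure_itv/= !lte_fin.
  by rewrite ltrD2r; case: ifP => // _; rewrite -!EFinD; congr EFin; ring.
rewrite ge0_integral_pushforward//= ?pre//.
  by apply/measurable_EFinP; exact: measurable_funTS.
by move=> y _; rewrite lee_fin.
Qed.

Lemma limn_einf_measurable {d} {T : measurableType d} (D : set T) (v : (T -> \bar R)^nat) :
  (forall n, measurable_fun D (v n)) -> measurable_fun D (fun x => limn_einf (v^~ x)).
Proof.
move=> mv; rewrite (_ : (fun _ => _) = (fun x => - limn_esup (fun n => - v n x))%E); last first.
  by apply/funext => x; have := limn_esupN (v^~ x); rewrite /comp => ->; rewrite oppeK.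
apply: (measurableT_comp (f := -%E)) => //; apply: measurable_fun_limn_esup => n.
exact: (measurableT_comp _ (mv n)).
Qed.

(* Fatou's lemma for the difference quotients, whose integrals telescope; the window
   in [F (b + 1)] leaves room for steps of length at most 1. *)
Lemma monotone_ge_integral (F u : R -> R) a b : a <= b ->
  (forall s t, a <= s -> s <= t -> F s <= F t) ->
  measurable_fun `]a, b] u -> (forall t, 0 <= u t) ->
  {ae leb, forall t, `]a, b]%classic t -> exists2 l, u t <= l &
     n.+1%:R * (F (t + n.+1%:R^-1) - F t) @[n --> \oo] --> l} ->
  (\int[leb]_(t in `]a, b]) (u t)%:E <= (F (b + 1) - F a)%:E)%E.
Proof.
move=> ab Fmono mu u0 uF.
(* Freezing [F] to the left of [a] and subtracting [F a] gives a nonnegative monotone, hence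
   measurable, function on the whole line. *)
pose F0 t := F (Num.max a t) - F a.
have F0mono : {homo F0 : s t / s <= t}.
  move=> s t st; rewrite /F0 lerD2r; apply: Fmono; first by rewrite le_max lexx.
  by rewrite ge_max !le_max lexx st orbT.
have F00 t : 0 <= F0 t by rewrite subr_ge0 Fmono// le_max lexx.
have mF0 : measurable_fun setT F0 by exact: nondecreasing_measurable.
pose v (n : nat) (t : R) : R := n.+1%:R * (F0 (t + n.+1%:R^-1) - F0 t).
have v0 n t : 0 <= v n t by rewrite mulr_ge0// subr_ge0 F0mono// lerDl invr_ge0.
have mFs (n : nat) : measurable_fun setT (fun t : R => F0 (t + n.+1%:R^-1)).
  by apply: (measurableT_comp mF0); exact: measurable_funD.
have mv n : measurable_fun setT (v n).
  by apply: measurable_funM => //; exact: measurable_funB.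
have Iv n : (\int[leb]_(t in `]a, b]) (v n t)%:E <= (F0 (b + 1))%:E)%E.
  set h := n.+1%:R^-1 : R.
  have h0 : 0 < h by rewrite invr_gt0.
  have h1 : h <= 1 by rewrite invf_le1// ler1n.
  have bound (s t : R) : s <= t -> (\int[leb]_(x in `]s, t]) (F0 x)%:E <= (F0 t * (t - s))%:E)%E.
    move=> st; apply: (@le_trans _ _ (\int[leb]_(x in `]s, t]) (F0 t)%:E)%E).
      apply: ge0_le_integral => //; try by move=> x _; rewrite lee_fin.
        by apply/measurable_EFinP/measurable_funTS.
      by move=> x; rewrite /= in_itv/= lee_fin => /andP[_ xt]; exact: F0mono.
    have leb_st : leb `]s, t]%classic = (t - s)%:E.
      rewrite lebesgue_measure_itv/= lte_fin; case: ltgtP st => // ->.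
      by rewrite subrr.
    by rewrite integral_cst// [X in (_ * X)%E]leb_st.
  have I0 : (0 <= \int[leb]_(x in `]a, b]) (F0 x)%:E)%E.
    by apply: integral_ge0 => x _; rewrite lee_fin.
  have Ifin : (\int[leb]_(x in `]a, b]) (F0 x)%:E)%E \is a fin_num.
    by rewrite ge0_fin_numE// (le_lt_trans (bound _ _ ab))// ltry.
  (* The shifted window exceeds []a, b]] only by []b, b + h]], which contributes at most
     [h * F0 (b + 1)]; the factor [n.+1 = 1 / h] then leaves exactly [F0 (b + 1)]. *)
  have shift_le : (\int[leb]_(x in `]a, b]) (F0 (x + h))%:E <=
      \int[leb]_(x in `]a, b]) (F0 x)%:E + (F0 (b + 1) * h)%:E)%E.
    rewrite ge0_integral_itv_shift//.
    apply: (@le_trans _ _ (\int[leb]_(x in `]a, b] `|` `]b, (b + h)%R]) (F0 x)%:E)%E).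
      apply: ge0_subset_integral => //.
      - exact: measurableU.
      - by apply/measurable_EFinP/measurable_funTS.
      - by move=> x _; rewrite lee_fin.
      - move=> x /=; rewrite !in_itv/= => /andP[ax xb].
        have [xb'|bx] := leP x b; [left|right] => //.
        by rewrite andbT; lra.
    rewrite ge0_integral_setU//; last 3 first.
    - by apply/measurable_EFinP/measurable_funTS.
    - by move=> x _; rewrite lee_fin.
    - apply/disj_setPS => x [/=]; rewrite !in_itv/= => /andP[_ xb] /andP[bx _].
      by move: xb; rewrite leNgt bx.
    have bbh : b <= b + h by rewrite lerDl ltW.
    rewrite leeD2l//; apply: (le_trans (bound _ _ bbh)).
    rewrite (_ : b + h - b = h); last by ring.
    by rewrite lee_fin; apply: ler_wpM2r; [exact: ltW|apply: F0mono; rewrite lerD2l].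
  (* Stated as a sum rather than a difference, so that additivity for nonnegative functions
     applies. *)
  have : (\int[leb]_(t in `]a, b]) (v n t)%:E + n.+1%:R%:E * \int[leb]_(t in `]a, b]) (F0 t)%:E
     = n.+1%:R%:E * \int[leb]_(t in `]a, b]) (F0 (t + h))%:E)%E.
    have mF0a : measurable_fun `]a, b] (fun t => (F0 t)%:E).
      by apply/measurable_EFinP; exact: measurable_funTS.
    have mFsa : measurable_fun `]a, b] (fun t => (F0 (t + h))%:E).
      by apply/measurable_EFinP; exact: measurable_funTS (mFs n).
    rewrite -!ge0_integralZl//; try by move=> x _; rewrite lee_fin.
    have mva : measurable_fun `]a, b] (fun t => (v n t)%:E).
      by apply/measurable_EFinP; exact: measurable_funTS (mv n).
    have mnF : measurable_fun `]a, b] (fun t => (n.+1%:R%:E * (F0 t)%:E)%E).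
      by apply: (measurable_funeM _ mF0a).
    have nF0 x : (0 <= n.+1%:R%:E * (F0 x)%:E)%E by rewrite mule_ge0 ?lee_fin.
    rewrite -ge0_integralD//; try by move=> x _; rewrite ?nF0 ?lee_fin.
    by apply: eq_integral => x _; rewrite [LHS]/= [RHS]/=; congr EFin; rewrite /v; ring.
  move=> vE.
  have : (n.+1%:R%:E * \int[leb]_(t in `]a, b]) (F0 (t + h))%:E <=
      n.+1%:R%:E * (\int[leb]_(x in `]a, b]) (F0 x)%:E + (F0 (b + 1) * h)%:E))%E.
    by rewrite lee_wpmul2l// lee_fin.
  rewrite -vE -(fineK Ifin) -EFinM -leeBrDr//.
  move=> /le_trans; apply; rewrite [leLHS]/= lee_fin.
  have hn : n.+1%:R * h = 1 by rewrite mulfV.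
  rewrite [leLHS](_ : _ = F0 (b + 1) * (n.+1%:R * h)); last by ring.
  by rewrite hn mulr1.
have FE : F (b + 1) - F a = F0 (b + 1).
  by rewrite /F0 max_r// (le_trans ab)// lerDl.
rewrite FE; apply: (@le_trans _ _ (\int[leb]_(t in `]a, b]) limn_einf (fun n => (v n t)%:E))%E).
  apply: ae_ge0_le_integral => //.
  - by move=> t _; rewrite lee_fin.
  - exact/measurable_EFinP.
  - move=> t _; rewrite limn_einf_lim; apply: lime_ge; first exact: is_cvg_einfs.
    apply: nearW => n; apply: le_ereal_inf_tmp => _ [i _ <-].
    by rewrite lee_fin.
  - by apply: limn_einf_measurable => n; apply/measurable_EFinP; exact: measurable_funTS (mv n).
  apply: filterS uF => t tF tab; have [l ul vl] := tF tab.
  have vl' : (v n t)%:E @[n --> \oo] --> l%:E.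
    apply: cvg_EFin; first exact: nearW.
    suff -> : fine \o (fun n => (v n t)%:E) = (fun n => n.+1%:R * (F (t + n.+1%:R^-1) - F t)) by [].
    apply/funext => n /=; move: tab; rewrite /= in_itv/= => /andP[/ltW at_ _].
    rewrite /v /F0 !max_r// ?(le_trans at_) ?lerDl ?invr_ge0//; ring.
  by have [-> _] := cvg_limn_einf_sup vl'; rewrite lee_fin.
apply: (le_trans (fatou _ _ _ _)) => //.
- by move=> n; apply/measurable_EFinP; exact: measurable_funTS (mv n).
- by move=> n x _; rewrite lee_fin.
rewrite limn_einf_lim; apply: lime_le; first exact: is_cvg_einfs.
apply: nearW => n; apply: le_trans (Iv n).
by apply: ereal_inf_lbound; exists n => /=.
Qed.
End MonotoneDerivative.

(** * Narrow convergence *)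

Section Portmanteau.
Context {R : realType} {d : measure_display} {X : measurableType d}.
Context (dX : X -> X -> R) (dX_polish : polish_metric dX) (dX_borel : borel_sigma dX).
Local Notation PX := (probability X R).

Let dX_ge0 x y : 0 <= dX x y := polish_ge0 dX_polish x y.
Let dXxx x : dX x x = 0 := polish_refl dX_polish x.
Let dXC x y : dX x y = dX y x := polish_sym dX_polish x y.
Let dX_tri y x z : dX x z <= dX x y + dX y z := polish_triangle dX_polish y x z.

Lemma EFin_RintegralT (mu : PX) (phi : X -> R) : mu.-integrable setT (EFin \o phi) ->
  ((\int[mu]_x phi x)%:E = \int[mu]_x (phi x)%:E)%E.
Proof. by move=> iphi; rewrite /Rintegral fineK//; exact: integrable_fin_num. Qed.

Section LipschitzEnvelope.
Context (phi : X -> R) (M : R).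
Hypothesis phiM : forall x, `|phi x| <= M.
Hypothesis phiC : forall x (e : R), 0 < e -> exists2 del : R, 0 < del &
     forall y, dX x y < del -> `|phi x - phi y| < e.

(** The Pasch-Hausdorff envelope, that is, the inf-convolution of [phi] with [k] times the
    distance. *)
Definition lipschitz_envelope (k : nat) x := inf [set phi y + k%:R * dX x y | y in setT].
Local Notation phi_ := lipschitz_envelope.

Let phi_lb k x : lbound [set phi y + k%:R * dX x y | y in setT] (- M).
Proof.
move=> _ [y _ <-]; have := phiM y; rewrite ler_norml => /andP[h _].
by rewrite (le_trans h)// lerDl mulr_ge0.
Qed.

Lemma lipschitz_envelope_le_add k x y : phi_ k x <= phi y + k%:R * dX x y.
Proof. by apply: ge_inf; [exists (- M); exact: phi_lb|exists y]. Qed.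

Lemma lipschitz_envelope_le k x : phi_ k x <= phi x.
Proof. by have := lipschitz_envelope_le_add k x x; rewrite dXxx mulr0 addr0. Qed.

Lemma lipschitz_envelope_bounded k x : `|phi_ k x| <= M.
Proof.
have := phiM x; rewrite !ler_norml => /andP[_ h]; apply/andP; split.
  by apply: lb_le_inf => //; exists (phi x + k%:R * dX x x), x.
exact: le_trans (lipschitz_envelope_le k x) h.
Qed.

Lemma lipschitz_envelope_lipschitz k x y : `|phi_ k x - phi_ k y| <= k%:R * dX x y.
Proof.
wlog suff : x y / phi_ k x <= phi_ k y + k%:R * dX x y.
  by move=> h; have := h x y; have := h y x; rewrite (dXC y x) ler_norml => ? ?; apply/andP; split; lra.
rewrite -lerBlDr; apply: lb_le_inf; first by exists (phi y + k%:R * dX y y), y.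
move=> _ [z _ <-]; rewrite lerBlDr (le_trans (lipschitz_envelope_le_add k x z))//.
by rewrite -addrA lerD2l -mulrDr ler_wpM2l// addrC.
Qed.

(** Competitors within [del] of [x] lose at most [e] by continuity; farther ones pay a penalty
    [k * del], which eventually exceeds the oscillation [2 * M]. *)
Lemma lipschitz_envelope_cvg x : phi_ k x @[k --> \oo] --> phi x.
Proof.
apply/cvgrPdist_le => e e0; have [del del0 phidel] := phiC x e0.
near=> k; rewrite ger0_norm ?subr_ge0 ?lipschitz_envelope_le// lerBlDl -lerBlDr.
apply: lb_le_inf; first by exists (phi x + k%:R * dX x x), x.
move=> _ [y _ <-]; have [xy|xy] := ltP (dX x y) del.
  have := phidel y xy; rewrite ltr_distlC => /andP[h _].
  have : 0 <= k%:R * dX x y by rewrite mulr_ge0.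
  lra.
have kdel : 2 * M <= k%:R * dX x y.
  apply: (@le_trans _ _ (k%:R * del)); last by rewrite ler_wpM2l.
  rewrite -ler_pdivrMr//; near: k; exact: nbhs_infty_ger.
have := phiM x; have := phiM y; rewrite !ler_norml => /andP[h1 _] /andP[_ h2]; lra.
Unshelve. all: by end_near. Qed.

Lemma lipschitz_envelope_cvg_integral (nu : PX) :
  (\int[nu]_x phi_ k x) @[k --> \oo] --> \int[nu]_x phi x.
Proof.
have mphi_ k := measurable_dcontinuous dX_borel (lipschitz_dcontinuous dX_polish (lipschitz_envelope_lipschitz k)).
have mphi := measurable_dcontinuous dX_borel phiC.
have [|||_ _] := @dominated_convergence _ _ _ nu setT measurableT
  (fun k x => (phi_ k x)%:E) (fun x => (phi x)%:E) (EFin \o cst M)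
  (fun k => (measurable_EFinP _ _).2 (mphi_ k)) ((measurable_EFinP _ _).2 mphi).
- apply: aeW => x _; apply: cvg_EFin; first exact: nearW.
  exact: lipschitz_envelope_cvg.
- exact: finite_measure_integrable_cst.
- by apply: aeW => x k _; rewrite lee_fin lipschitz_envelope_bounded.
rewrite -EFin_RintegralT//; last exact: bounded_integrable mphi phiM.
exact: fine_cvg.
Qed.

End LipschitzEnvelope.

Lemma Rintegral_cvgP (mu : nat -> PX) (nu : PX) (phi : X -> R) (M : R) :
  measurable_fun setT phi -> (forall x, `|phi x| <= M) ->
  ((\int[mu n]_x (phi x)%:E)%E @[n --> \oo] --> (\int[nu]_x (phi x)%:E)%E) <->
  ((\int[mu n]_x phi x) @[n --> \oo] --> \int[nu]_x phi x).
Proof.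
move=> mphi phiM; rewrite -EFin_RintegralT//; last exact: bounded_integrable mphi phiM.
split; first exact: fine_cvg.
by apply: cvg_EFin; apply: nearW => n; apply: integrable_fin_num => //; exact: bounded_integrable mphi phiM.
Qed.

(** [Wp_lipschitz] settles Lipschitz test functions. A general [phi] lies above its envelopes, which
    gives the lower bound on its integrals, and the upper bound is the lower one for [- phi]. *)
Lemma narrow_cvg_Wp (p : R) (mu nu : nat -> PX) (kap : PX) : 1 < p ->
  (\forall n \near \oo, Pp dX p (mu n)) -> (\forall n \near \oo, Pp dX p (nu n)) ->
  Wp dX p (mu n) (nu n) @[n --> \oo] --> 0 ->
  narrow_cvg dX nu kap -> narrow_cvg dX mu kap.
Proof.
move=> p1 Pmu Pnu W0 nukap.
have lip psi M k : (forall x, `|psi x| <= M) -> (forall x y, `|psi x - psi y| <= k%:R * dX x y) ->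
    (\int[mu n]_x psi x) @[n --> \oo] --> \int[kap]_x psi x.
  move=> psiM psik; have psiC := lipschitz_dcontinuous dX_polish psik.
  have mpsi := measurable_dcontinuous dX_borel psiC.
  have ipsi (m : PX) : m.-integrable setT (EFin \o psi) by exact: bounded_integrable mpsi psiM.
  have := nukap psi (conj (ex_intro _ M psiM) psiC).
  move=> /(Rintegral_cvgP _ _ mpsi psiM)/cvgrPdist_lt nupsi.
  apply/cvgrPdist_lt => e e0; have e20 : 0 < e / 2 by rewrite divr_gt0.
  (* Chosen so that [k * (del + del) < e / 2]; [k + 1] avoids a division by zero when [k = 0]. *)
  pose del := e / 2 / (k%:R + 1) / 2.
  have k1 : 0 < k%:R + 1 :> R by rewrite ltr_wpDl.
  have del0 : 0 < del by rewrite !divr_gt0.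
  have kdel : k%:R * (del + del) < e / 2.
    have -> : e / 2 = (k%:R + 1) * (del + del) by rewrite /del; field; rewrite gt_eqF.
    by rewrite ltr_pM2r ?ltrDl// addr_gt0.
  move/cvgrPdist_lt : W0 => /(_ _ del0) W0.
  near=> n.
  have h1 : `|\int[kap]_x psi x - \int[nu n]_x psi x| < e / 2 by near: n; exact: nupsi.
  have Wn : Wp dX p (mu n) (nu n) < del.
    by rewrite (le_lt_trans (ler_norm _))// -normrN -sub0r; near: n.
  have Pmun : Pp dX p (mu n) by near: n.
  have Pnun : Pp dX p (nu n) by near: n.
  have := Wp_lipschitz dX_polish dX_borel p1 Pmun Pnun (ler0n _ k) del0 psiM psik Wn.
  rewrite -!EFin_RintegralT// -EFinB lee_fin.
  have -> : del `^ (1 - p) * del `^ p = del.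
    by rewrite -powRD ?subrK ?powRr1// ?ltW// gt_eqF ?implybT.
  move=> /le_lt_trans/(_ kdel) h2.
  have := ler_distD (\int[nu n]_x psi x) (\int[kap]_x psi x) (\int[mu n]_x psi x).
  rewrite [X in _ <= _ + X]distrC; lra.
have lower (phi : X -> R) M : (forall x, `|phi x| <= M) ->
    (forall x (e : R), 0 < e -> exists2 del : R, 0 < del &
       forall y, dX x y < del -> `|phi x - phi y| < e) ->
    forall e, 0 < e -> \forall n \near \oo, \int[kap]_x phi x - e < \int[mu n]_x phi x.
  move=> phiM phiC e e0; have e20 : 0 < e / 2 by rewrite divr_gt0.
  have mphi := measurable_dcontinuous dX_borel phiC.
  have /cvgrPdist_lt/(_ _ e20)[k _ /(_ k (leqnn k))/=] := lipschitz_envelope_cvg_integral phiM phiC (nu := kap).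
  rewrite ltr_distlC => /andP[hk _].
  have psiM := lipschitz_envelope_bounded phiM k.
  have psik := lipschitz_envelope_lipschitz phiM k.
  have mpsi := measurable_dcontinuous dX_borel (lipschitz_dcontinuous dX_polish psik).
  have /cvgrPdist_lt/(_ _ e20) := lip _ _ _ psiM psik.
  apply: filterS => n; rewrite ltr_distlC => /andP[hn _].
  have : \int[mu n]_x lipschitz_envelope phi k x <= \int[mu n]_x phi x.
    apply: le_Rintegral => //.
    - exact: bounded_integrable mpsi psiM.
    - exact: bounded_integrable mphi phiM.
    - by move=> x _; exact: lipschitz_envelope_le phiM k x.
  lra.
move=> phi [[M phiM] phiC]; have mphi := measurable_dcontinuous dX_borel phiC.
apply/(Rintegral_cvgP _ _ mphi phiM)/cvgrPdist_lt => e e0.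
have NphiM x : `|- phi x| <= M by rewrite normrN.
have NphiC x (e' : R) : 0 < e' -> exists2 del : R, 0 < del &
    forall y, dX x y < del -> `|- phi x - - phi y| < e'.
  move=> e'0; have [del del0 phidel] := phiC x e' e'0; exists del => // y /phidel.
  by rewrite -opprD normrN.
have NI (m : PX) : \int[m]_x - phi x = - \int[m]_x phi x.
  rewrite -mulN1r -RintegralZl//; last exact: bounded_integrable mphi phiM.
  by apply: eq_Rintegral => x _; rewrite mulN1r.
apply: filterS2 (lower _ _ phiM phiC e e0) (lower _ _ NphiM NphiC e e0) => n h1.
by rewrite !NI => h2; rewrite ltr_distlC; apply/andP; split; lra.
Unshelve. all: by end_near. Qed.

End Portmanteau.

(** * Limit points of curves of maximal slope *)

Lemma slope_seq_cvg {R : realType} (F : R -> R) t : derivable F t 1 ->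
  n.+1%:R * (F (t + n.+1%:R^-1) - F t) @[n --> \oo] --> derive1 F t.
Proof.
move=> /slope_cvg/cvgrPdist_lt Ft; apply/cvgrPdist_lt => e e0.
have [del /= del0 Fdel] := Ft e e0.
near=> n; have := Fdel (t + n.+1%:R^-1).
rewrite /slope /= opprD addNKr normrN addrAC subrr add0r invrK mulrC; apply.
  rewrite ger0_norm ?invr_ge0//; near: n; exact: near_infty_natSinv_lt (PosNum del0).
by rewrite -subr_eq0 addrAC subrr add0r invr_neq0.
Unshelve. all: by end_near. Qed.

Lemma limn_einf_le_near {R : realType} (u : (\bar R)^nat) (x : \bar R) :
  (\forall n \near \oo, (u n <= x)%E) -> (limn_einf u <= x)%E.
Proof.
move=> [N _ ux]; rewrite limn_einf_lim; apply: lime_le; first exact: is_cvg_einfs.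
apply: nearW => n; apply: (@le_trans _ _ (u (maxn n N))); last first.
  by apply: ux; rewrite /= leq_maxr.
by apply: ereal_inf_lbound; exists (maxn n N) => //=; rewrite leq_maxl.
Qed.

Section Curve.
Context {R : realType} {d : measure_display} {X : measurableType d}.
Context (dX : X -> X -> R) (dX_polish : polish_metric dX) (dX_borel : borel_sigma dX).
Context (p : R) (p1 : 1 < p).
Local Notation PX := (probability X R).
Local Notation leb := (@lebesgue_measure R).
Let p0 : 0 < p. Proof. exact: lt_trans p1. Qed.

Lemma metric_derivative_density (T : R) (rho : R -> PX) : 0 < T -> AC_on dX p T rho ->
  exists g : R -> R, [/\ forall x, 0 <= g x, leb.-integrable setT (EFin \o g),
    forall s t, 0 <= s -> s <= t -> t <= T ->
      Wp dX p (rho s) (rho t) <= \int[leb]_(x in `]s, t]) g x &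
    {ae leb, forall t, 0 < t < T -> metric_derivative dX p rho t = g t}].
Proof.
move=> T0 [rhoP [m [intm rhom]]].
pose cl (x : R) := Num.max 0 (Num.min x T).
have cl0T x : 0 <= cl x <= T by rewrite le_max lexx/= ge_max (ltW T0) ge_min lexx orbT.
have clE x : 0 <= x <= T -> cl x = x by move=> /andP[x0 xT]; rewrite /cl min_l ?max_r.
have clmono s t : s <= t -> cl s <= cl t.
  by move=> st; rewrite /cl ge_max !le_max lexx/= !le_min !ge_min st lexx orbT orbT.
pose W s t := Wp dX p (rho (cl s)) (rho (cl t)).
pose ma := (fun x => `|m x|) \_ `[0, T].
have ma0 x : 0 <= ma x by rewrite /ma patchE; case: ifP.
have intma : leb.-integrable setT (EFin \o ma).
  rewrite /ma -restrict_EFin -integrable_mkcond//.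
  exact: (integrable_abse intm).
have mma : measurable_fun setT (EFin \o ma) by exact: measurable_int intma.
have Wma s t : s <= t -> W s t <= \int[leb]_(x in `]s, t]) ma x.
  move=> st; have := clmono _ _ st; rewrite le_eqVlt => /predU1P[cst|cst].
    by rewrite /W cst (Wpxx dX_polish dX_borel p1); apply: Rintegral_ge0.
  rewrite -lee_fin EFin_Rintegral//.
  have /andP[s0 sT] := cl0T s; have /andP[t0 tT] := cl0T t.
  rewrite /W (Wp_sym dX_polish dX_borel p1); [|exact: rhoP|exact: rhoP].
  apply: (le_trans (rhom _ _ s0 cst tT)).
  have sub0T : `[cl s, cl t] `<=` `[0, T]%classic.
    by move=> x; rewrite /= !in_itv/= => /andP[? ?]; apply/andP; split; lra.
  have intmst : leb.-integrable `[cl s, cl t] (EFin \o m) by exact: integrableS intm.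
  have h1 : (\int[leb]_(x in `[cl s, cl t]) (m x)%:E <= \int[leb]_(x in `[cl s, cl t]) `|(m x)%:E|)%E.
    apply: (le_trans (lee_abs _)); apply: le_abse_integral => //.
    exact: measurable_int intmst.
  have h2 : (\int[leb]_(x in `[cl s, cl t]) `|(m x)%:E| = \int[leb]_(x in `[cl s, cl t]) (ma x)%:E)%E.
    by apply: eq_integral => x /set_mem/sub0T x0T; rewrite /= /ma patchE mem_set.
  apply: (le_trans h1); rewrite h2.
  rewrite -integral_itv_obnd_cbnd; last exact: measurable_funTS.
  apply: ge0_subset_integral => //.
  - exact: measurable_funTS.
  - by move=> x _; rewrite lee_fin.
  - move=> x /=; rewrite !in_itv/= => /andP[xs xt].
    (* [cl s < cl t] rules out [s] above [T] and [t] below 0, so clamping can only shrink the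
       interval. *)
    have sle : s <= cl s.
      rewrite /cl; have [sT'|/ltW Ts] := leP s T; first by rewrite le_max lexx orbT.
      have clsT : cl s = T by rewrite /cl min_r// max_r// ltW.
      by move: (lt_le_trans cst tT); rewrite clsT ltxx.
    have tge : cl t <= t.
      rewrite /cl ge_max ge_min lexx andbT leNgt; apply/negP => tlt0.
      have clt0 : cl t = 0 by rewrite /cl max_l// ge_min (ltW tlt0).
      by move: (le_lt_trans s0 cst); rewrite clt0 ltxx.
    by rewrite (le_lt_trans sle xs) (le_trans xt tge).
have Prho x : Pp dX p (rho (cl x)) by exact: rhoP.
have [g [g0 intg Wg gW]] := @ac_pseudometric_derivative _ W ma
  (fun s t => Wp_ge0 dX p _ _) (fun t => Wpxx dX_polish dX_borel p1 _)
  (fun s t => Wp_sym dX_polish dX_borel p1 (Prho s) (Prho t))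
  (fun r s t => Wp_triangle dX_polish dX_borel p1 (Prho s) (Prho r) (Prho t))
  ma0 intma Wma.
exists g; split => // [s t s0 st tT|].
  have := Wg s t st; rewrite /W !clE//; [by rewrite (le_trans s0 st)|by rewrite s0 (le_trans st)].
apply: filterS gW => t /cvgrPdist_lt Wgt /andP[t0 tT].
have near0T : \forall s \near t^', 0 <= s <= T.
  exists (Num.min t (T - t)) => /=; first by rewrite lt_min t0 subr_gt0.
  move=> s /= + _; rewrite lt_min ltr_norml ltr_norml => /andP[/andP[_ h1] /andP[h2 _]].
  by apply/andP; split; lra.
suff h : Wp dX p (rho t) (rho s) / `|t - s| @[s --> t^'] --> g t.
  exact: (cvg_lim (@Rhausdorff R) h).
apply/cvgrPdist_lt => e e0; apply: filterS2 near0T (Wgt e e0) => s s0T.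
have t0T : 0 <= t <= T by rewrite (ltW t0) (ltW tT).
by rewrite /W (clE t t0T) (clE s s0T).
Qed.

Section MaximalSlope.
Context (E G : PX -> \bar R) (rho : R -> PX) (phi : R -> R).
Hypothesis G_ge0 : nonneg_on_Pp dX p G.
Hypothesis rhoAC : AC_loc dX p rho.
Hypothesis Ephi : {ae leb, forall t, 0 <= t -> E (rho t) = (phi t)%:E}.
Hypothesis phi_mono : forall s t, 0 <= s -> s <= t -> phi t <= phi s.
Hypothesis phi_slope : {ae leb, forall t, 0 <= t ->
  derivable phi t 1 /\
  ((derive1 phi t)%:E = - ((metric_derivative dX p rho t `^ p) / p)%:E
                        - poweR (G (rho t)) (qexp p) * ((qexp p)^-1)%:E)%E}.

Let Gpow t := (poweR (G (rho t)) (qexp p) * ((qexp p)^-1)%:E)%E.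

Let q0 : 0 < qexp p. Proof. by rewrite /qexp divr_gt0 ?subr_gt0. Qed.

Let Gpow_ge0 t : (0 <= Gpow t)%E.
Proof. by rewrite mule_ge0 ?poweR_ge0// lee_fin invr_ge0 ltW. Qed.

(** Both terms of the slope identity are nonnegative, so [- derive1 phi t] bounds each; its
    finiteness excludes an infinite slope. *)
Lemma ae_slope_bounds : {ae leb, forall t, 0 <= t -> derivable phi t 1 /\
  (metric_derivative dX p rho t `^ p <= p * - derive1 phi t /\
   (Gpow t <= (- derive1 phi t)%:E)%E)}.
Proof.
apply: filterS phi_slope => t /[apply] -[dphi eqphi]; split => //.
have md0 : 0 <= metric_derivative dX p rho t `^ p / p by rewrite divr_ge0 ?powR_ge0// ltW.
rewrite -ler_pdivrMl// [p^-1 * _]mulrC; have := Gpow_ge0 t.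
move: eqphi; rewrite -/(Gpow t).
move: (_ / p) md0 (derive1 phi t) => x x0 r.
by case: (Gpow t) => //= z [->]; rewrite !lee_fin => z0; split; lra.
Qed.

(** The integral bound for monotone functions is applied to [del * t - c * phi t]. The term
    [2 * del] is its linear growth over [[a, a + 2]], and the factor [p] in [c] undoes the [1 / p]
    of the slope identity. *)
Lemma Wp_energy_bound a s del : 0 <= a -> a <= s <= a + 1 -> 0 < del ->
  Wp dX p (rho s) (rho a) <= 2 * del + p * del `^ (1 - p) * (phi a - phi (a + 2)).
Proof.
(* Any [T] beyond [a + 1] would do: the metric derivative is identified strictly inside []0, T[]. *)
move=> a0 /andP[as_ sa] del0; pose T := a + 3.
have T0 : 0 < T by rewrite /T; lra.
have [g [g0 intg Wg gmd]] := metric_derivative_density T0 (rhoAC.2 T T0).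
rewrite (Wp_sym dX_polish dX_borel p1); [|by apply: rhoAC.1; lra|exact: rhoAC.1].
apply: (le_trans (Wg a s a0 as_ _)); first by rewrite /T; lra.
apply: (@le_trans _ _ (\int[leb]_(x in `]a, a + 1]) g x)).
  rewrite -lee_fin !EFin_Rintegral//; apply: ge0_subset_integral => //.
  - by apply: measurable_funTS; exact: measurable_int intg.
  - by move=> x _; rewrite lee_fin.
  - by move=> x /=; rewrite !in_itv/= => /andP[-> xs]; rewrite (le_trans xs).
pose c := del `^ (1 - p) * p.
have c0 : 0 <= c by rewrite mulr_ge0 ?powR_ge0// ltW.
pose F t := del * t - c * phi t.
have := @monotone_ge_integral R F g a (a + 1).
have -> : a + 1 + 1 = a + 2 by ring.
rewrite -EFin_Rintegral// lee_fin /F => h.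
have -> : 2 * del + p * del `^ (1 - p) * (phi a - phi (a + 2)) =
    del * (a + 2) - c * phi (a + 2) - (del * a - c * phi a) by rewrite /c; ring.
apply: h => //.
- by rewrite lerDl.
- move=> u v au uv; apply: lerB; first by rewrite ler_pM2l.
  by rewrite ler_wpM2l// phi_mono// (le_trans a0).
- by apply: measurable_funTS; apply/measurable_EFinP; exact: measurable_int intg.
apply: filterS2 gmd ae_slope_bounds => t gt bounds; rewrite /= in_itv/= => /andP[at_ ta].
have t0 : 0 < t by lra.
have [dphi [md _]] := bounds (ltW t0).
exists (del - c * derive1 phi t).
  have gt' : metric_derivative dX p rho t = g t by apply: gt; apply/andP; split; rewrite /T; lra.
  rewrite gt' in md.
  apply: (le_trans (le_add_powR p1 del0 (g0 t))).
  rewrite lerD2l -mulrN /c -mulrA ler_wpM2l ?powR_ge0//.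
have -> : (fun n => n.+1%:R * (del * (t + n.+1%:R^-1) - c * phi (t + n.+1%:R^-1) - (del * t - c * phi t))) =
    (fun n => del - c * (n.+1%:R * (phi (t + n.+1%:R^-1) - phi t))).
  apply/funext => n; have : n.+1%:R * n.+1%:R^-1 = 1 :> R by rewrite mulfV.
  move: (n.+1%:R) (_^-1) (phi _) (phi t) => N h y z Nh.
  rewrite (_ : N * _ = del * (N * h) - c * (N * (y - z))); last by ring.
  by rewrite Nh mulr1.
by apply: cvgB; [exact: cvg_cst|apply: cvgMr; exact: slope_seq_cvg].
Qed.

(** Otherwise [- derive1 phi >= e] almost everywhere on the window of length 1, and [phi] would drop
    by at least [e] over [[a, a + 2]]. *)
Lemma exists_small_slope a e : 0 <= a -> phi a - phi (a + 2) < e ->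
  exists s, [/\ a <= s <= a + 1, E (rho s) = (phi s)%:E & (Gpow s <= e%:E)%E].
Proof.
move=> a0 phie; apply: contrapT => nex.
have e0 : 0 <= e by rewrite (le_trans _ (ltW phie))// subr_ge0 phi_mono// lerDl.
have := @monotone_ge_integral R (fun t => - phi t) (fun=> e) a (a + 1).
have -> : a + 1 + 1 = a + 2 by ring.
rewrite integral_cst// opprK [- _ + _]addrC => h; have {h} : (e%:E <= (phi a - phi (a + 2))%:E)%E.
  have leb1 : leb `]a, a + 1]%classic = 1%E.
    by rewrite lebesgue_measure_itv/= lte_fin ltrDl ltr01 -EFinD addrAC subrr add0r.
  move: h; rewrite [X in (_ * X)%E]leb1 mule1; apply => //.
  - by rewrite lerDl.
  - by move=> u v au uv; rewrite lerN2 phi_mono// (le_trans a0).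
  apply: filterS2 Ephi ae_slope_bounds => t Et bounds; rewrite /= in_itv/= => /andP[at_ ta].
  have t0 : 0 <= t by lra.
  have [dphi [_ Gt]] := bounds t0.
  exists (- derive1 phi t).
    rewrite leNgt; apply/negP => lte; apply: nex; exists t; split; [|exact: Et|].
      by rewrite (ltW at_) ta.
    by apply: (le_trans Gt); rewrite lee_fin ltW.
  have -> : (fun n => n.+1%:R * (- phi (t + n.+1%:R^-1) - - phi t)) =
      (fun n => - (n.+1%:R * (phi (t + n.+1%:R^-1) - phi t))).
    by apply/funext => n; rewrite -mulrN opprD.
  by apply: cvgN; exact: slope_seq_cvg.
by rewrite lee_fin leNgt phie.
Qed.

(** The common core of both inclusions; no moment of [nu] is assumed. *)
Lemma narrow_limit_small_slope (c : R) (tn : nat -> R) (nu : PX) :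
  (forall mu, Pp dX p mu -> (c%:E <= E mu)%E) ->
  tn @ \oo --> +oo -> narrow_cvg dX (rho \o tn) nu ->
  exists s : nat -> R, [/\ forall n, 0 <= s n, narrow_cvg dX (rho \o s) nu,
    forall n, (E (rho (s n)) <= (phi 0)%:E)%E &
    forall e, 0 < e -> \forall n \near \oo, (G (rho (s n)) <= e%:E)%E].
Proof.
move=> Ec tny tnnu.
(* [phi] may differ from [E] at [t], so the bound is read at a later time where they agree and
   carried back by monotonicity. *)
have phic t : 0 <= t -> c <= phi t.
  move=> t0; have lt1 : phi t - phi (t + 2) < phi t - phi (t + 2) + 1 by rewrite ltrDl.
  have [s [/andP[ts _] Es _]] := exists_small_slope t0 lt1.
  rewrite (le_trans _ (phi_mono t0 ts))// -lee_fin -Es; apply: Ec; apply: rhoAC.1.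
  exact: le_trans ts.
(* Finitely many [tn n] may be negative, where the curve is not controlled. *)
pose a n := Num.max 0 (tn n).
have a0 n : 0 <= a n by rewrite le_max lexx.
have ay : a n @[n --> \oo] --> +oo.
  apply/cvgryPge => A; move/cvgryPge : tny => /(_ A); apply: filterS => n An.
  by rewrite le_max An orbT.
have phia : forall e, 0 < e -> \forall n \near \oo, phi (a n) - phi (a n + 2) < e.
  move=> e e0; pose S := phi @` [set t | 0 <= t].
  have S_inf : has_inf S.
    split; first by exists (phi 0), 0 => //=.
    by exists c => _ [t t0 <-]; exact: phic.
  have [_ [A A0 <-] phiA] := inf_adherent e0 S_inf.
  move/cvgryPge : ay => /(_ A); apply: filterS => n An.
  have h1 := phi_mono A0 An.
  have h2 : inf S <= phi (a n + 2).
    by apply: ge_inf; [exact: S_inf.2|exists (a n + 2) => //=; rewrite addr_ge0].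
  lra.
(* The slack [n.+1^-1] provides the strict inequality even if [phi] is constant on the window. *)
have /choice[s sP] : forall n, exists s, [/\ a n <= s <= a n + 1, E (rho s) = (phi s)%:E &
    (Gpow s <= (phi (a n) - phi (a n + 2) + n.+1%:R^-1)%:E)%E].
  by move=> n; apply: exists_small_slope => //; rewrite ltrDl invr_gt0.
have as_ n : a n <= s n by have [/andP[]] := sP n.
have s0 n : 0 <= s n by exact: le_trans (as_ n).
exists s; split => //.
- have anu : narrow_cvg dX (rho \o a) nu.
    move=> psi /tnnu; apply: cvg_trans; apply: near_eq_cvg.
    move/cvgryPge : tny => /(_ 0); apply: filterS => n tn0.
    by rewrite /= /a max_r.
  apply: (narrow_cvg_Wp dX_polish dX_borel p1) anu.
  + by apply: nearW => n; exact: rhoAC.1.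
  + by apply: nearW => n; exact: rhoAC.1.
  apply/cvgrPdist_lt => e e0.
  pose del := e / 4; have del0 : 0 < del by rewrite divr_gt0.
  pose K := p * del `^ (1 - p).
  have K0 : 0 < K by rewrite mulr_gt0 ?powR_gt0.
  have eK0 : 0 < e / 2 / K by rewrite !divr_gt0.
  apply: filterS (phia _ eK0) => n phin.
  rewrite sub0r normrN ger0_norm ?Wp_ge0//.
  have [sn _ _] := sP n.
  apply: (le_lt_trans (Wp_energy_bound (a0 n) sn del0)); rewrite -/K.
  move: phin; rewrite ltr_pdivlMr// mulrC /del; lra.
- by move=> n; have [_ -> _] := sP n; rewrite lee_fin phi_mono.
move=> e e0; have q0' : 0 < (qexp p)^-1 by rewrite invr_gt0.
(* [e'] is the value of [Gpow] at slope [e]; half is spent on the energy drop, half on the slack. *)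
pose e' := e `^ qexp p / qexp p; have e'0 : 0 < e' / 2.
  by apply: divr_gt0 => //; apply: divr_gt0 => //; exact: powR_gt0.
near=> n; have [_ _ Gn] := sP n.
have G0 : (0 <= G (rho (s n)))%E by apply: G_ge0; exact: rhoAC.1.
have : (Gpow (s n) <= e'%:E)%E.
  apply: (le_trans Gn); rewrite lee_fin.
  have h1 : phi (a n) - phi (a n + 2) < e' / 2 by near: n; exact: phia.
  have h2 : n.+1%:R^-1 < e' / 2 by near: n; exact: near_infty_natSinv_lt (PosNum e'0).
  by rewrite [leRHS]splitr lerD// ltW.
rewrite /Gpow /e' EFinM; rewrite lee_pmul2r ?lte_fin// => hG.
rewrite leNgt; apply/negP => lteG; move: hG; apply/negP; rewrite -ltNge.
case: (G (rho (s n))) lteG G0 => [r| |]//=; rewrite ?lte_fin => er r0.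
- by apply: gt0_ltr_powR => //; rewrite nnegrE ltW// (lt_trans e0).
- by rewrite gt_eqF// ltry.
Unshelve. all: by end_near. Qed.

End MaximalSlope.

Lemma lsc_limit_bounds (E G : PX -> \bar R) (mu : nat -> PX) (nu : PX) (C : R) :
  (E nu <= limn_einf (E \o mu))%E -> (G nu <= limn_einf (G \o mu))%E -> (0 <= G nu)%E ->
  (forall n, (E (mu n) <= C%:E)%E) ->
  (forall e, 0 < e -> \forall n \near \oo, (G (mu n) <= e%:E)%E) ->
  (E nu < +oo)%E /\ G nu = 0%E.
Proof.
move=> El Gl G0 EC Ge; split.
  rewrite (le_lt_trans El)// (@le_lt_trans _ _ C%:E) ?ltry//.
  by apply: limn_einf_le_near; exact: nearW.
apply/eqP; rewrite eq_le G0 andbT; apply/lee_addgt0Pr => e e0.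
by rewrite add0e (le_trans Gl)//; apply: limn_einf_le_near; exact: Ge.
Qed.

(** [Wp mu mu = 0] makes the metric derivative vanish, so the slope identity reads [0 = 0] for the
    representative [fine (E mu)]. *)
Lemma constant_max_slope (E G : PX -> \bar R) (mu : PX) :
  Pp dX p mu -> E mu \is a fin_num -> G mu = 0%E -> max_slope_curve dX p E G (fun=> mu).
Proof.
move=> Pmu Efin Gmu0; have Wmu := Wpxx dX_polish dX_borel p1 mu.
split.
  split=> // T T0; split => //; exists (fun=> 0); split.
    by rewrite (_ : EFin \o _ = cst 0%E)//; exact: integrable0.
  by move=> s t _ _ _; rewrite Wmu integral0_eq.
exists (fun=> fine (E mu)); split; [|split => //].
  by apply: aeW => t _; rewrite fineK.
apply: aeW => t _; split; first exact: derivable_cst.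
have md0 : metric_derivative dX p (fun=> mu) t = 0.
  rewrite /metric_derivative (_ : (fun _ => _) = cst 0); first exact: lim_cst.
  by apply/funext => s; rewrite Wmu mul0r.
have q0 : qexp p != 0 by rewrite /qexp mulf_neq0 ?invr_eq0 ?gt_eqF ?subr_gt0.
by rewrite md0 Gmu0 powR0 ?gt_eqF// poweR0r// mul0r mul0e sube0 oppe0 derive1E derive_cst.
Qed.

End Curve.

Theorem theorem2p15 (R : realType) (d : measure_display) (X : measurableType d)
  (dX : X -> X -> R) (p : R)
  (E G : probability X R -> \bar R) (rho0 : probability X R) (rho : R -> probability X R) :
  polish_metric dX -> borel_sigma dX -> 1 < p ->
  proper_on_Pp dX p E -> nonneg_on_Pp dX p G ->
  weak_upper_gradient dX p E G ->
  ZEp dX p E rho0 -> max_slope_curve dX p E G rho -> rho 0 = rho0 ->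
  ((A1 dX p E /\ A3 dX p G /\ (A2 dX p E \/ A2' dX p E rho)) ->
     omega_limit dX p rho `<=` stationary dX p E G)
  /\
  (forall Et Gt : probability X R -> \bar R,
     extends dX p E G Et Gt -> B1 dX Et -> B3 dX Gt ->
     (B2 dX Et \/ B2' dX p E rho) ->
     omega'_limit dX rho `<=` weak_stationary Et Gt).
Proof.
move=> dX_polish dX_borel p1 [Eproper _] G_ge0 _ _ [rhoAC [phi [Ephi [phi_mono phi_slope]]]] _.
split=> [[[_ [[c Ec] Elsc]] [Glsc _]] nu [Pnu [tn [tny tnnu]]]|].
  have [s [s0 snu EC Ge]] := narrow_limit_small_slope dX_polish dX_borel p1
    G_ge0 rhoAC Ephi phi_mono phi_slope Ec tny tnnu.
  have Ps n : Pp dX p (rho (s n)) by exact: rhoAC.1.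
  have [Enu Gnu] := lsc_limit_bounds (Elsc _ _ Ps Pnu snu) (Glsc _ _ Ps Pnu snu) (G_ge0 _ Pnu) EC Ge.
  split=> //; split=> //; apply: constant_max_slope => //.
  by rewrite fin_numE Eproper// lt_eqF.
(* The limit may leave [Pp], so semicontinuity is used for the extensions; the curve stays in [Pp],
   where they agree with [E] and [G]. *)
move=> Et Gt [_ [Gt0 EGt]] [_ [[c Ec] Elsc]] Glsc _ nu [tn [tny tnnu]].
have Ec' mu : Pp dX p mu -> (c%:E <= E mu)%E by move=> /EGt[<- _].
have [s [s0 snu EC Ge]] := narrow_limit_small_slope dX_polish dX_borel p1
  G_ge0 rhoAC Ephi phi_mono phi_slope Ec' tny tnnu.
have EGs n : Et (rho (s n)) = E (rho (s n)) /\ Gt (rho (s n)) = G (rho (s n)).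
  by apply: EGt; exact: rhoAC.1.
apply: (lsc_limit_bounds (Elsc _ _ snu) (Glsc _ _ snu) (Gt0 _) (C := phi 0)).
  by move=> n; rewrite /= (EGs n).1.
by move=> e /Ge; apply: filterS => n; rewrite /= (EGs n).2.
Qed.
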